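(* For every integer $n\ge2$, $$\mathcal M_n=\overline{\mathcal R_n\cap(\mathbb C\setminus\overline{\mathbb D})}^{\,\mathbb C}\cap(\mathbb C\setminus\overline{\mathbb D})=\overline{\mathcal R_n\cap(\mathbb C\setminus\overline{\mathbb D})}^{\,\mathbb C\setminus\overline{\mathbb D}},$$ where the superscript denotes the space in which the closure is taken. In particular, $\mathcal M_n$ is closed in $\mathbb C\setminus\overline{\mathbb D}$. Equivalently, $c\in\mathcal M_n$ if and only if $c\in\mathbb C\setminus\overline{\mathbb D}$ and there exists a sequence $(d_k)_{k\ge1}$ of elements of $D_n$ such that $1+\sum_{k=1}^{\infty}d_kc^{-k}=0$.
   Context: Let $\mathbb D=\{z\in\mathbb C:|z|<1\}$. For an integer $n\ge2$ put $D_n=\{-n+1,-n+2,\ldots,n-1\}$ and $A_n=\{-n+1,-n+3,\ldots,n-1\}$. Let $$\mathcal R_n=\Big\{c\in\mathbb C:\ c^m+\sum_{j=0}^{m-1}d_jc^j=0\text{ for some }m\ge1\text{ and }d_0,\ldots,d_{m-1}\in D_n\Big\}.$$ For $c\in\mathbb C\setminus\overline{\mathbb D}$, let $E(c,n)$ be the attractor of the iterated function system $\{f_t(z)=t+z/c: t\in A_n\}$, i.e. the unique nonempty compact set with $E(c,n)=\bigcup_{t\in A_n}f_t(E(c,n))$. Put $\mathcal M_n=\{c\in\mathbb C\setminus\overline{\mathbb D}: E(c,n)\text{ is connected}\}$. *)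

(* Defs.v *)
From HB Require Import structures.
From mathcomp Require Import all_boot all_order all_algebra.
From mathcomp Require Import all_classical all_reals all_analysis.
From mathcomp Require Import complex.

Set Implicit Arguments.
Unset Strict Implicit.
Unset Printing Implicit Defensive.

Import Order.TTheory GRing.Theory Num.Theory.
Import numFieldNormedType.Exports.

Local Open Scope classical_set_scope.
Local Open Scope ring_scope.

(* The complex numbers are R[i] for R : realType. The modulus topology lives on
   the regular module R[i]^o; this copies it to R[i] itself. *)
HB.instance Definition _ (R : realType) := NormedModule.copy R[i] R[i]^o.

Definition unit_disk (R : realType) : set R[i] := [set z | `|z| < 1].
Arguments unit_disk : clear implicits.

(* C minus the closed unit disk *)
Definition exterior (R : realType) : set R[i] := ~` closure (unit_disk R).
Arguments exterior : clear implicits.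

Definition D (n : nat) : set int := [set d | - n%:Z + 1 <= d <= n%:Z - 1].

Definition A (n : nat) : set int :=
  [set t | exists2 j : nat, (j < n)%N & t = - n%:Z + 1 + 2 * j%:Z].

(* The coefficient sequence d is only constrained and used at indices < m. *)
Definition Rset (R : realType) (n : nat) : set R[i] :=
  [set c | exists (m : nat) (d : nat -> int),
     [/\ (1 <= m)%N,
         forall j, (j < m)%N -> D n (d j) &
         c ^+ m + \sum_(j < m) (d j)%:~R * c ^+ j = 0]].
Arguments Rset : clear implicits.

Definition ifs_map (R : realType) (c : R[i]) (t : int) (z : R[i]) : R[i] :=
  t%:~R + z / c.

Definition is_attractor (R : realType) (c : R[i]) (n : nat) (K : set R[i]) :=
  [/\ K !=set0, compact K & K = \bigcup_(t in A n) (ifs_map c t @` K)].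

(* By Hutchinson's theorem there is exactly one attractor when 1 < `|c| and
   1 <= n, so the default value set0 is never taken in that range. *)
Definition attractor (R : realType) (c : R[i]) (n : nat) : set R[i] :=
  xget set0 (is_attractor c n).

Definition Mset (R : realType) (n : nat) : set R[i] :=
  [set c | exterior R c /\ connected (attractor c n)].
Arguments Mset : clear implicits.

(* Main.v *)
Require Import Defs.
From mathcomp Require Import all_boot all_order all_algebra.
From mathcomp Require Import all_classical all_reals all_analysis.
From mathcomp Require Import complex.
From mathcomp Require Import ring lra zify.

Set Implicit Arguments.
Unset Strict Implicit.
Unset Printing Implicit Defensive.

Import Order.TTheory GRing.Theory Num.Theory.
Import numFieldNormedType.Exports.
Local Open Scope classical_set_scope.
Local Open Scope ring_scope.

(* The pieces of the attractor [K] labelled [s] and [t] meet iff [K] has a chord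
   [c (t - s)].  If [K] is connected, some pieces with [t - s = 2 j] meet, and
   Hopf's theorem on parallel chords of a plane continuum turns a chord [2 c j]
   into a chord [2 c]; expanding its endpoints gives [1 + sum d_k c^-k = 0].
   Conversely this equation makes consecutive pieces meet, and pulling chains
   back along the contractions makes [K] chain connected at every scale.

   The sum converges to [0] iff the orbit [x_0 = 1], [x_(k+1) = c x_k + d_k]
   stays in the disc of radius [(n - 1) / (|c| - 1)], a closed condition on [c]
   by compactness of the space of digit sequences.

   Density is a Hurwitz argument.  If no truncation [P_m] has a zero near
   [z0 = 1/c], the minimum modulus principle gives, on each small circle about
   [z0], points where [|P_m| <= 2 |P_m z0|], and in the limit a zero of the power
   series on each of these circles.  But the series has finitely many zeros in a
   disc of radius less than 1: dividing out Blaschke factors multiplies the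
   constant term and preserves the l2-norm of the coefficients. *)

(** * The real-valued modulus and the topology it induces *)

Section Modulus.
Variable R : realType.
Implicit Types z w : R[i].

(** The norm of [R[i]] takes its values in [R[i]]; a copy with values in [R] gives a total order and
    makes [lra] and [nra] applicable. *)
Definition cmod z : R := complex.Re `|z|.

Lemma cmodE z : `|z| = (cmod z)%:C%C.
Proof. by rewrite /cmod RRe_real. Qed.

Lemma cmod_ge0 z : 0 <= cmod z.
Proof. by rewrite -lecR -cmodE normr_ge0. Qed.

Lemma cmod0 : cmod 0 = 0.
Proof. by rewrite /cmod normr0. Qed.

Lemma cmod1 : cmod 1 = 1.
Proof. by rewrite /cmod normr1. Qed.

Lemma cmodM z w : cmod (z * w) = cmod z * cmod w.
Proof. by rewrite {1}/cmod normrM !cmodE -rmorphM. Qed.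

Lemma cmodX z k : cmod (z ^+ k) = cmod z ^+ k.
Proof. by rewrite {1}/cmod normrX cmodE -rmorphXn. Qed.

Lemma cmodN z : cmod (- z) = cmod z.
Proof. by rewrite /cmod normrN. Qed.

Lemma cmodV z : cmod z^-1 = (cmod z)^-1.
Proof. by rewrite {1}/cmod normfV cmodE -fmorphV. Qed.

Lemma cmod_div z w : cmod (z / w) = cmod z / cmod w.
Proof. by rewrite cmodM cmodV. Qed.

Lemma cmodB z w : cmod (z - w) = cmod (w - z).
Proof. by rewrite -cmodN opprB. Qed.

Lemma ler_cmodD z w : cmod (z + w) <= cmod z + cmod w.
Proof. by rewrite -lecR rmorphD /= -!cmodE ler_normD. Qed.

Lemma ler_cmodB z w : cmod (z - w) <= cmod z + cmod w.
Proof. by rewrite -(cmodN w) ler_cmodD. Qed.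

Lemma ler_cmod_distD v z w : cmod (z - w) <= cmod (z - v) + cmod (v - w).
Proof. by apply: le_trans (ler_cmodD _ _); rewrite addrA subrK. Qed.

Lemma lerB_cmod z w : cmod z - cmod w <= cmod (z - w).
Proof. by rewrite lerBlDr -{1}(subrK w z) ler_cmodD. Qed.

Lemma cmod_eq0 z : (cmod z == 0) = (z == 0).
Proof. by rewrite -(inj_eq (@complexI R)) /= -cmodE normr_eq0. Qed.

Lemma cmod_gt0 z : (0 < cmod z) = (z != 0).
Proof. by rewrite lt_def cmod_ge0 andbT cmod_eq0. Qed.

Lemma cmod_real (x : R) : cmod x%:C%C = `|x|.
Proof. by rewrite /cmod normc_def /= expr0n addr0 sqrtr_sqr. Qed.

Lemma cmod_int (k : int) : cmod k%:~R = `|k%:~R|.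
Proof. by rewrite -cmod_real rmorph_int. Qed.

Lemma cmod_prod I (r : seq I) (F : I -> R[i]) :
  cmod (\prod_(i <- r) F i) = \prod_(i <- r) cmod (F i).
Proof. by elim/big_rec2: _ => [|i x a _ <-]; rewrite ?cmod1 ?cmodM. Qed.

Lemma ler_Re_cmod z : `|complex.Re z| <= cmod z.
Proof. by rewrite -lecR -cmodE normc_ge_Re. Qed.

Lemma ler_Im_cmod z : `|complex.Im z| <= cmod z.
Proof.
rewrite /cmod normc_def /= -sqrtr_sqr ler_wsqrtr //.
by rewrite lerDr sqr_ge0.
Qed.

Lemma ler_cmod_ReIm z : cmod z <= `|complex.Re z| + `|complex.Im z|.
Proof.
rewrite {1}[z]complexE; apply: le_trans (ler_cmodD _ _) _.
rewrite cmodM !cmod_real; suff -> : cmod 'i%C = 1 by rewrite mul1r.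
by rewrite /cmod normc_def /= expr0n expr1n add0r sqrtr1.
Qed.

Lemma nbhs_cmodP z (P : set R[i]) :
  nbhs z P <-> exists2 e : R, 0 < e & forall w, cmod (w - z) < e -> P w.
Proof.
split => [/nbhs_ballP[e e0 He]|[e e0 He]].
- exists (complex.Re e); first by move: e0; rewrite /= ltcE => /andP[].
  move=> w wz; apply: He; rewrite -ball_normE /ball_ /=.
  rewrite cmodE cmodB.
  move: wz; rewrite -ltcR RRe_real // ger0_real //; exact: ltW.
- apply/nbhs_ballP; exists e%:C%C; first by rewrite /= ltcR.
  by move=> w; rewrite -ball_normE /ball_ /= cmodE ltcR cmodB => /He.
Qed.

Lemma near_cmod z (e : R) : 0 < e -> \forall w \near z, cmod (w - z) < e.
Proof. by move=> e0; apply/nbhs_cmodP; exists e. Qed.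

Lemma closure_cmodP (B : set R[i]) z :
  closure B z <-> forall e : R, 0 < e -> exists2 w, B w & cmod (w - z) < e.
Proof.
split => [cB e e0|H P /nbhs_cmodP[e e0 He]].
  by have [w [Bw wz]] := cB _ (near_cmod z e0); exists w.
by have [w Bw wz] := H e e0; exists w; split => //; apply: He.
Qed.

Lemma lipschitz_cmod_continuous (f : R[i] -> R) :
  (forall z w, `|f z - f w| <= cmod (z - w)) -> continuous f.
Proof.
move=> lf z P /nbhs_ballP[e e0 He]; apply/nbhs_cmodP; exists e => // w wz.
apply: He; rewrite /ball /=; apply: le_lt_trans wz.
by rewrite cmodB.
Qed.

Lemma cmod_continuous : continuous cmod.
Proof.
apply: lipschitz_cmod_continuous => z w.
by rewrite ler_norml lerBlDr; have := lerB_cmod w z; have := lerB_cmod z w;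
  rewrite (cmodB w z); lra.
Qed.

Lemma Im_continuous : continuous (@complex.Im R).
Proof.
by apply: lipschitz_cmod_continuous => z w; rewrite -raddfB ler_Im_cmod.
Qed.

Lemma cvg_cmodP T (F : set_system T) {FF : Filter F} (f : T -> R[i]) z :
  f @ F --> z <-> forall e : R, 0 < e -> \forall t \near F, cmod (f t - z) < e.
Proof.
split => [fz e e0|H P /nbhs_cmodP[e e0 He]].
  by have := fz _ (near_cmod z e0); rewrite near_map.
by apply: filterS (H e e0) => t; apply: He.
Qed.

Lemma compact_box (B : R) :
  compact [set z : R[i] | `|complex.Re z| <= B /\ `|complex.Im z| <= B].
Proof.
pose f (p : R * R) : R[i] := (p.1%:C + 'i * p.2%:C)%C.
suff <- : f @` (`[- B, B] `*` `[- B, B]) =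
    [set z : R[i] | `|complex.Re z| <= B /\ `|complex.Im z| <= B].
  apply: continuous_compact; last first.
    by apply: compact_setX; exact: segment_compact.
  apply: continuous_subspaceT => -[x y] P /nbhs_cmodP[e e0 He].
  have e20 : 0 < e / 2 by rewrite divr_gt0.
  exists (ball x (e / 2), ball y (e / 2)).
    by split; apply: nbhsx_ballx.
  move=> [u v] [/= ux vy]; apply: He.
  apply: le_lt_trans (ler_cmod_ReIm _) _.
  move: ux vy; rewrite /ball /= (distrC x) (distrC y) => ux vy.
  rewrite /= !(mul0r, mul1r, subr0, addr0, add0r).
  by rewrite [e]splitr ltrD.
rewrite eqEsubset; split => [_ [[x y] /= [+ +] <-]|z [/= xB yB]].
  rewrite !in_itv /= -!ler_norml => xB yB.
  by rewrite !(mul0r, mul1r, subr0, addr0, add0r).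
exists (complex.Re z, complex.Im z); last by rewrite /f /= -complexE.
by rewrite /= !in_itv /= -!ler_norml.
Qed.

End Modulus.

(** * Winding numbers of discrete maps into the punctured plane *)

Section DiscreteWinding.
Variable R : realFieldType.
Implicit Types z w : R * R.

(* Signed crossings of the negative real axis. *)
Definition crossing z w : int :=
  if (z.1 < 0) && (w.1 < 0) then (w.2 < 0)%R%:Z - (z.2 < 0)%R%:Z else 0.

Definition close (e : R) z w := `|z.1 - w.1| <= e /\ `|z.2 - w.2| <= e.

(** The 1-norm stands in for the modulus: a [realFieldType] need not have square roots, and [lra]
    can treat absolute values once they are split. *)
Definition away (d : R) z := d <= `|z.1| + `|z.2|.

Lemma crossing_anti z w : crossing z w + crossing w z = 0.
Proof.
by rewrite /crossing andbC; case: ifP => _; rewrite ?addr0 // addrC subrKA subrr.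
Qed.

Lemma closeC e z w : close e z w -> close e w z.
Proof. by rewrite /close distrC (distrC z.2). Qed.

Lemma close_trans e f z v w : close e z v -> close f v w -> close (e + f) z w.
Proof.
by move=> [a b] [c h]; split;
  [apply: le_trans (ler_distD v.1 _ _) _|apply: le_trans (ler_distD v.2 _ _) _];
  apply: lerD.
Qed.

(** If [z.1 < 0], the nearby [v] forces [|z.1| <= 2 * e], so [|z.2| >= d - 2 * e > e], and a step of
    size [e] cannot change the sign of the second coordinate. *)
Lemma crossing_eq0 e d z v w : 3 * e < d -> away d z ->
  close e z w -> close (2 * e) z v -> 0 <= v.1 -> crossing z w = 0.
Proof.
rewrite /away /close /crossing; case: z v w => [zx zy] [vx vy] [wx wy] /=.
move=> ed az [/ler_normlP[_ _] /ler_normlP[w1 w2]] [/ler_normlP[v1 v2] _] vx0.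
case: ifP => // /andP[zx0 wx0]; move: az; rewrite (ltr0_norm zx0).
by case: (ltrP zy 0) => hz; case: (ltrP wy 0) => hw; rewrite ?subrr //;
  [rewrite (ltr0_norm hz)|rewrite (ger0_norm hz)] => az; exfalso; lra.
Qed.

(** If all four corners have negative first coordinate, [crossing] is a difference of values at the
    ends and telescopes. Otherwise some corner [v] has [v.1 >= 0] and lies within [2 * e] of the
    start of each edge, so all four terms vanish by [crossing_eq0]. *)
Lemma crossing_square e d z00 z10 z01 z11 : 3 * e < d ->
  away d z00 -> away d z10 -> away d z01 -> away d z11 ->
  close e z00 z10 -> close e z10 z11 -> close e z00 z01 -> close e z01 z11 ->
  crossing z00 z01 + crossing z01 z11 = crossing z00 z10 + crossing z10 z11.
Proof.
move=> ed a00 a10 a01 a11 c1 c2 c3 c4.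
have e0 : 0 <= e by case: c1 => + _; exact: le_trans.
have tw z v w : close e z v -> close e v w -> close (2 * e) z w.
  by rewrite mulr2n mulrDl mul1r; exact: close_trans.
have wk z w : close e z w -> close (2 * e) z w.
  by move=> [h1 h2]; split; [apply: le_trans h1 _|apply: le_trans h2 _]; lra.
have rf z : close (2 * e) z z by split; rewrite subrr normr0; lra.
have [/andP[/andP[n00 n10] /andP[n01 n11]]|] :=
    boolP (((z00.1 < 0) && (z10.1 < 0)) && ((z01.1 < 0) && (z11.1 < 0))).
  by rewrite /crossing n00 n10 n01 n11 /=; ring.
move=> hv; have [v [v00 v10 v01 v0]] : exists v, [/\ close (2 * e) z00 v,
    close (2 * e) z10 v, close (2 * e) z01 v & 0 <= v.1].
  move: hv; rewrite !negb_and -!leNgt => /orP[/orP[h|h]|/orP[h|h]].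
  - by exists z00; split=> //; apply: wk; apply: closeC.
  - exists z10; split=> //; first exact: wk.
    exact: tw (closeC c3) c1.
  - exists z01; split=> //; first exact: wk.
    exact: tw (closeC c1) c3.
  - exists z11; split=> //; [exact: tw c1 c2|exact: wk|exact: wk].
by rewrite (crossing_eq0 ed a00 c3 v00 v0) (crossing_eq0 ed a01 c4 v01 v0)
  (crossing_eq0 ed a00 c1 v00 v0) (crossing_eq0 ed a10 c2 v10 v0).
Qed.

Lemma crossing_upper z w : 0 <= z.2 -> 0 <= w.2 -> crossing z w = 0.
Proof.
by rewrite /crossing !leNgt => /negbTE -> /negbTE ->; rewrite subrr; case: ifP.
Qed.

Definition on_cut z : bool := (z.1 < 0) && (z.2 == 0).

(** In the closed lower half-plane a second coordinate is negative iff it is nonzero, so [crossing]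
    is the coboundary of the indicator of the cut. If only one end has negative first coordinate, it
    is within [e] of the vertical axis, and [away] keeps it off the cut. *)
Lemma crossing_lower e d z w : e < d -> away d z -> away d w -> close e z w ->
  z.2 <= 0 -> w.2 <= 0 -> crossing z w = (on_cut z)%:Z - (on_cut w)%:Z.
Proof.
rewrite /away /close /crossing /on_cut; case: z w => [zx zy] [wx wy] /=.
move=> ed az aw [/ler_normlP[x1 x2] /ler_normlP[y1 y2]] z0 w0.
case: (ltrP zx 0) => hz; case: (ltrP wx 0) => hw //=.
- by move: z0 w0; rewrite !le_eqVlt => /predU1P[->|zn] /predU1P[->|wn];
    rewrite ?eqxx ?ltxx ?zn ?wn ?(lt_eqF zn) ?(lt_eqF wn).
- case: (eqVneq zy 0) => // zy0; move: az; rewrite zy0 normr0 ltr0_norm // => az'; exfalso; lra.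
- case: (eqVneq wy 0) => // wy0; move: aw; rewrite wy0 normr0 ltr0_norm // => az'; exfalso; lra.
Qed.

(** A closed discrete 1-form on the quadrant is exact: integrate along [j = 0], then in the second
    index. *)
Lemma grid_potential (H V : nat -> nat -> int) :
  (forall i j, V i j + H i j.+1 = H i j + V i.+1 j) ->
  exists T : nat -> nat -> int, (forall i j, T i.+1 j = T i j + H i j) /\
    (forall i j, T i j.+1 = T i j + V i j).
Proof.
move=> HV; pose T i j := \sum_(k < i) H k 0%N + \sum_(l < j) V i l.
have TV i j : T i j.+1 = T i j + V i j by rewrite /T big_ord_recr addrA.
exists T; split => // i; elim => [|j IH].
  by rewrite /T !big_ord0 !addr0 big_ord_recr.
by rewrite !TV IH -!addrA HV.
Qed.

(** [T] lifts the argument, counted in full turns. Where [g] is constant on the diagonal, the two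
    edges between consecutive diagonal points have opposite crossings, which cancel. *)
Lemma grid_winding e d (g : nat -> nat -> R * R) : 3 * e < d ->
  (forall i j, away d (g i j)) ->
  (forall i j, close e (g i j) (g i.+1 j)) ->
  (forall i j, close e (g i j) (g i j.+1)) ->
  exists T : nat -> nat -> int,
  [/\ forall i j, T i.+1 j = T i j + crossing (g i j) (g i.+1 j),
      forall p, (forall i, g i i = p) -> forall i k, T i i = T k k,
      forall i, (forall j, 0 <= (g i j).2) -> forall j k, T i j = T i k &
      forall i, (forall j, (g i j).2 <= 0) -> forall j k,
        T i j + (on_cut (g i j))%:Z = T i k + (on_cut (g i k))%:Z].
Proof.
move=> ed ag cH cV.
have [|T [TH TV]] := @grid_potential (fun i j => crossing (g i j) (g i.+1 j))
    (fun i j => crossing (g i j) (g i j.+1)).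
  by move=> i j; apply: (crossing_square ed).
have const (f : nat -> int) : (forall i, f i.+1 = f i) -> forall i k, f i = f k.
  move=> fS; suff f0 i : f i = f 0%N by move=> i k; rewrite (f0 i) (f0 k).
  by elim: i => // i <-.
exists T; split => //.
- move=> p gp; apply: const => i; rewrite TV TH gp gp -addrA.
  by rewrite crossing_anti addr0.
- by move=> i gi; apply: const => j; rewrite TV crossing_upper // addr0.
- move=> i gi; apply: (const (fun j => T i j + _)) => j.
  rewrite TV (@crossing_lower e d) //; first lia.
  have e0 : 0 <= e by case: (cH 0%N 0%N) => + _; exact: le_trans.
  lra.
Qed.

(* Hopf's horizontal chord argument.  The arguments of [g i - g j - a] and of
   [g i - g j + b] are followed along the rows of a highest and of a lowest
   point, where the imaginary part keeps a constant sign. *)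
Lemma discrete_chord (e d a b : R) (x y : nat -> R) (N top bot : nat) :
  0 < a -> 0 < b -> 3 * e < d ->
  (forall i, `|x i.+1 - x i| <= e) -> (forall i, `|y i.+1 - y i| <= e) ->
  (forall i j, d <= `|x i - x j - a| + `|y i - y j|) ->
  (forall i j, d <= `|x i - x j - b| + `|y i - y j|) ->
  x N - x 0%N = a + b -> y N = y 0%N ->
  (forall j, y j <= y top) -> (forall j, y bot <= y j) -> False.
Proof.
move=> a0 b0 ed xe ye da db xN yN ytop ybot.
pose ga i j := (x i - x j - a, y i - y j).
pose gb i j := (x i - x j + b, y i - y j).
have [|||Ta [TaH Tad Tau Tal]] := @grid_winding e d ga ed.
- by move=> i j; apply: da.
- by move=> i j; apply: closeC; split => /=;
    [rewrite (_ : _ - _ = x i.+1 - x i)|rewrite (_ : _ - _ = y i.+1 - y i)] => //; ring.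
- by move=> i j; split => /=;
    [rewrite (_ : _ - _ = x j.+1 - x j)|rewrite (_ : _ - _ = y j.+1 - y j)] => //; ring.
have [|||Tb [TbH Tbd Tbu Tbl]] := @grid_winding e d gb ed.
- move=> i j; rewrite /away /= -normrN.
  rewrite (_ : - (x i - x j + b) = x j - x i - b); last by ring.
  by rewrite (distrC (y i)); apply: db.
- by move=> i j; apply: closeC; split => /=;
    [rewrite (_ : _ - _ = x i.+1 - x i)|rewrite (_ : _ - _ = y i.+1 - y i)] => //; ring.
- by move=> i j; split => /=;
    [rewrite (_ : _ - _ = x j.+1 - x j)|rewrite (_ : _ - _ = y j.+1 - y j)] => //; ring.
(* As [x N - x 0 = a + b], the two maps agree here, so [Ta i 0] and [Tb i N] have the same
   increments in [i]. *)
have gab i : gb i N = ga i 0%N.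
  by rewrite /gb /ga yN; congr (_, _); move: xN; lra.
have E i : Tb i N - Ta i 0%N = Tb 0%N N - Ta 0%N 0%N.
  elim: i => // i <-; rewrite TbH TaH !gab; lia.
have ha : Ta top top = Ta bot bot.
  by apply: (Tad (- a, 0)) => i; rewrite /ga !subrr sub0r.
have hb : Tb top top = Tb bot bot.
  by apply: (Tbd (b, 0)) => i; rewrite /gb !subrr add0r.
have hau : Ta top 0%N = Ta top top by apply: Tau => j; rewrite subr_ge0.
have hbu : Tb top N = Tb top top by apply: Tbu => j; rewrite subr_ge0.
have hal : Ta bot 0%N + on_cut (ga bot 0%N) = Ta bot bot + on_cut (ga bot bot).
  by apply: Tal => j; rewrite subr_le0.
have hbl : Tb bot N + on_cut (gb bot N) = Tb bot bot + on_cut (gb bot bot).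
  by apply: Tbl => j; rewrite subr_le0.
(* The diagonal value [- a] of [ga] is on the cut, the diagonal value [b] of [gb] is not: the rows
   [top] and [bot] thus disagree by one turn. *)
have cuta : on_cut (ga bot bot) = true.
  by rewrite /on_cut /ga /= !subrr eqxx sub0r oppr_lt0 a0.
have cutb : on_cut (gb bot bot) = false.
  by rewrite /on_cut /gb /= subrr add0r ltNge ltW.
have := E top; rewrite -(E bot) hau hbu ha hb.
move: hal hbl; rewrite gab cuta cutb.
by move: (Ta bot 0%N) (Tb bot N) (Ta bot bot) (Tb bot bot) => p q r s; case: (on_cut _); lia.
Qed.

End DiscreteWinding.

(** * Chains of small steps, and Hopf's theorem on parallel chords *)

Section Chains.
Variable R : realType.
Implicit Types (K : set R[i]) (e : R) (x y z v w : R[i]).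

(** Each point of [B] has its own radius; covering compactness, along radii tending to [0] from the
    right, makes it uniform. *)
Lemma compact_thickening (B C : set R[i]) : compact B -> open C -> B `<=` C ->
  exists2 e, 0 < e & forall z w, B z -> cmod (w - z) < e -> C w.
Proof.
move=> /compact_near_coveringP cB oC BC.
have := cB _ (0 : R)^'+ (fun e z => forall w, cmod (w - z) < e -> C w).
case.
- move=> z Bz; have /nbhs_cmodP[r r0 Hr] : nbhs z C by apply: open_nbhs_nbhs; split => //; apply: BC.
  have r20 : 0 < r / 2 by rewrite divr_gt0.
  exists ([set z' | cmod (z' - z) < r / 2], [set e | e < r / 2]).
    split; first exact: near_cmod.
    exact: nbhs_right_lt.
  move=> [z' e] [/= zz' er] w wz'; apply: Hr.
  apply: le_lt_trans (ler_cmod_distD z' _ _) _; lra.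
- move=> e /= e0 He; exists (e / 2); first by rewrite divr_gt0.
  move=> z w Bz wz; apply: (He (e / 2) _ _ z Bz w wz) => /=; last first.
    by rewrite divr_gt0.
  rewrite sub0r normrN gtr0_norm ?divr_gt0 //; lra.
Qed.

(** Only the end of a step must lie in [K], so the start of a chain is unconstrained; this is why
    reversing a chain asks for [K z]. *)
Definition step K e : rel R[i] := fun z w => `[< K w /\ cmod (w - z) <= e >].

Definition chained K e z w := exists2 s, path (step K e) z s & last z s = w.

Lemma chained_refl K e z : chained K e z z.
Proof. by exists [::]. Qed.

Lemma chained_trans K e v z w : chained K e z v -> chained K e v w -> chained K e z w.
Proof.
by move=> [s ps <-] [t pt <-]; exists (s ++ t); rewrite ?cat_path ?last_cat ?ps.
Qed.

Lemma chained1 K e z w : K w -> cmod (w - z) <= e -> chained K e z w.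
Proof. by move=> Kw wz; exists [:: w] => //=; rewrite andbT; apply/asboolP. Qed.

Lemma chained_sym K e z w : K z -> chained K e z w -> chained K e w z.
Proof.
move=> Kz [s ps <-] {w}; elim: s z Kz ps => [|u s IH] z Kz /=.
  by move=> _; apply: chained_refl.
move=> /andP[/asboolP[Ku uz] ps]; apply: chained_trans (IH _ Ku ps) _.
by apply: chained1; rewrite // cmodB.
Qed.

Lemma chained_image K L e e' (f : R[i] -> R[i]) z w :
  (forall u, K u -> L (f u)) ->
  (forall u v, cmod (u - v) <= e -> cmod (f u - f v) <= e') ->
  chained K e z w -> chained L e' (f z) (f w).
Proof.
move=> fK fe [s ps <-] {w}; elim: s z ps => [|u s IH] z /=.
  by move=> _; apply: chained_refl.
move=> /andP[/asboolP[Ku uz] ps]; apply: chained_trans (IH _ ps).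
by apply: chained1; [apply: fK|apply: fe].
Qed.

(** The points of [K] reached from [z] form a relatively clopen set, since reached and unreached
    points are at least [e] apart. *)
Lemma connected_chained K e z w : connected K -> 0 < e -> K z -> K w ->
  chained K e z w.
Proof.
move=> cK e0 Kz Kw; pose B := [set u | K u /\ chained K e z u].
suff : B w by case.
have nb (S : set R[i]) : open [set u | exists2 v, S v & cmod (u - v) < e].
  rewrite openE => u [v Sv uv]; apply/nbhs_cmodP.
  exists (e - cmod (u - v)); first by rewrite subr_gt0.
  move=> t tu; exists v => //; apply: le_lt_trans (ler_cmod_distD u _ _) _; lra.
have ext u v : K v -> B u -> cmod (v - u) < e -> B v.
  move=> Kv [Ku zu] vu; split => //; apply: chained_trans zu _.
  by apply: chained1 => //; apply: ltW.
rewrite (cK B) //.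
- by exists z; split => //; apply: chained_refl.
- exists [set u | exists2 v, B v & cmod (u - v) < e] => //.
  apply/seteqP; split => [u Bu|u [Ku [v Bv uv]]]; last exact: ext uv.
  by split; [case: Bu|exists u => //; rewrite subrr cmod0].
- exists (~` [set u | exists2 v, (K `\` B) v & cmod (u - v) < e]).
    exact: open_closedC.
  apply/seteqP; split => [u Bu|u [Ku nu]].
    split; first by case: Bu.
    by move=> [v [Kv nBv] uv]; apply: nBv; apply: ext Bu _; rewrite ?(cmodB v).
  apply: contrapT => nBu; apply: nu; exists u => //.
  by rewrite subrr cmod0.
Qed.

(** A relatively clopen part [B] is compact, hence at some positive distance [e] from the rest of
    [K], and a chain with steps [e / 2] cannot leave it. *)
Lemma chained_connected K : compact K ->
  (forall e z w, 0 < e -> K z -> K w -> chained K e z w) -> connected K.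
Proof.
move=> cK H B [b Bb] [C oC BC] [D cD BD].
have cB : compact B by rewrite BD; apply: compact_closedI.
have [|e e0 He] := compact_thickening cB oC; first by rewrite BC => ? [].
apply/seteqP; split => [z|w Kw]; first by rewrite BC => -[].
have Kb : K b by move: Bb; rewrite BC => -[].
have e20 : 0 < e / 2 by rewrite divr_gt0.
have [s ps <-] := H _ _ _ e20 Kb Kw.
elim: s b Bb {Kb} ps => //= u s IH b Bb /andP[/asboolP[Ku ub] ps].
apply: IH ps; rewrite BC; split => //; apply: He Bb _; lra.
Qed.

Lemma compact_diff K : compact K -> compact [set p.1 - p.2 | p in K `*` K].
Proof.
move=> cK; apply: continuous_compact; last exact: compact_setX.
by apply: continuous_subspaceT; exact: sub_continuous.
Qed.

Lemma compact_closedC K : compact K -> closed K.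
Proof. by apply: compact_closed; exact: norm_hausdorff. Qed.

Lemma compact_avoids_diff K v : compact K -> (forall z w, K z -> K w -> z - w != v) ->
  exists2 d, 0 < d & forall z w, K z -> K w -> d <= cmod (z - w - v).
Proof.
move=> cK H; have /compact_closedC cD := compact_diff cK.
have : nbhs v (~` [set p.1 - p.2 | p in K `*` K]).
  apply: open_nbhs_nbhs; split; first exact: closed_openC.
  by move=> [[z w] /= [Kz Kw] zw]; have := H _ _ Kz Kw; rewrite zw eqxx.
move=> /nbhs_cmodP[d d0 Hd]; exists d => // z w Kz Kw.
by rewrite leNgt; apply/negP => /Hd; apply; exists (z, w).
Qed.

(** The missing chord lengths form an additive semigroup (Hopf). Otherwise a fine chain in [K] from
    [w] to [z], led through a highest and a lowest point of [K], would contradict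
    [discrete_chord]. *)
Lemma chord_additive K (a b : R) : compact K -> connected K -> 0 < a -> 0 < b ->
  (forall z w, K z -> K w -> z - w != a%:C%C) ->
  (forall z w, K z -> K w -> z - w != b%:C%C) ->
  forall z w, K z -> K w -> z - w != (a + b)%:C%C.
Proof.
move=> cK nK a0 b0 Ha Hb z w Kz Kw; apply/eqP => zw.
have [da da0 Hda] := compact_avoids_diff cK Ha.
have [db db0 Hdb] := compact_avoids_diff cK Hb.
pose d := Num.min da db; have d0 : 0 < d by rewrite lt_min da0.
pose e := d / 4; have e0 : 0 < e by rewrite divr_gt0.
have K0 : K !=set0 by exists z.
have cIm : {within K, continuous (@complex.Im R)}.
  by apply: continuous_subspaceT; exact: Im_continuous.
have [top /set_mem Kt Ht] := compact_EVT_max K0 cK cIm.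
have [bot /set_mem Kb Hb'] := compact_EVT_min K0 cK cIm.
have [s1 p1 l1] := connected_chained nK e0 Kw Kt.
have [s2 p2 l2] := connected_chained nK e0 Kt Kb.
have [s3 p3 l3] := connected_chained nK e0 Kb Kz.
pose s := s1 ++ s2 ++ s3.
have ps : path (step K e) w s by rewrite !cat_path p1 l1 p2 l2 p3.
have ls : last w s = z by rewrite !last_cat l1 l2 l3.
(* The default [z] keeps [g] constant after the end of the chain, so the bounds below hold at every
   index. *)
pose g i := nth z (w :: s) i.
have gS i : (i < size s)%N -> K (g i.+1) /\ cmod (g i.+1 - g i) <= e.
  by move=> si; have /(pathP z)/(_ i si)/asboolP := ps.
have gK i : K (g i).
  case: i => [|i]; first exact: Kw.
  have [/gS[]//|si] := ltnP i (size s).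
  by rewrite /g /= nth_default.
have ge i : cmod (g i.+1 - g i) <= e.
  have [/gS[]//|si] := ltnP i (size s).
  rewrite {1}/g /= nth_default //; move: si; rewrite leq_eqVlt => /predU1P[<-|si].
    by rewrite /g -last_nth ls subrr cmod0 ltW.
  by rewrite /g nth_default // subrr cmod0 ltW.
have gN : g (size s) = z by rewrite /g -last_nth ls.
have gtop : g (size s1) = top.
  by rewrite /g -cat_cons nth_cat /= ltnSn -last_nth l1.
have gbot : g (size (s1 ++ s2)) = bot.
  by rewrite /g /s catA -cat_cons nth_cat /= ltnSn -last_nth last_cat l1 l2.
pose x i := complex.Re (g i); pose y i := complex.Im (g i).
have far (c dc : R) : d <= dc ->
    (forall z w, K z -> K w -> dc <= cmod (z - w - c%:C%C)) ->
    forall i j, d <= `|x i - x j - c| + `|y i - y j|.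
  move=> dc' Hc i j; apply: le_trans dc' (le_trans (Hc _ _ (gK i) (gK j)) _).
  apply: le_trans (ler_cmod_ReIm _) _; rewrite !raddfB /= /x /y.
  by rewrite subr0.
apply: (@discrete_chord _ e d a b x y (size s) (size s1) (size (s1 ++ s2))) => //.
- rewrite /e; lra.
- by move=> i; apply: le_trans (ge i); rewrite -raddfB ler_Re_cmod.
- by move=> i; apply: le_trans (ge i); rewrite -raddfB ler_Im_cmod.
- by apply: far Hda; rewrite ge_min lexx.
- by apply: far Hdb; rewrite ge_min lexx orbT.
- by rewrite /x gN -raddfB zw.
- by apply/eqP; rewrite /y gN -subr_eq0 -raddfB zw.
- by move=> j; rewrite /y gtop; apply: Ht; rewrite inE.
- by move=> j; rewrite /y gbot; apply: Hb'; rewrite inE.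
Qed.

(** Dividing [K] by [v] turns the chord [v] into the chord [1]; if that one is missing, additivity
    rules out every positive integer. *)
Lemma chord_divide K v (j : nat) : compact K -> connected K -> K !=set0 ->
  (exists z w, [/\ K z, K w & z - w = v *+ j.+1]) ->
  exists z w, [/\ K z, K w & z - w = v].
Proof.
move=> cK nK [u Ku] [z [w [Kz Kw zw]]].
have [->|v0] := eqVneq v 0; first by exists u, u; rewrite subrr.
apply: contrapT => nv; pose L := (fun t => t / v) @` K.
have cf : {within K, continuous (fun t => t / v)}.
  by apply: continuous_subspaceT; exact: mulrr_continuous.
have cL : compact L by apply: continuous_compact.
have nL : connected L by apply: connected_continuous_connected.
have nL1 p q : L p -> L q -> p - q != 1%:C%C.
  move=> [p' Kp <-] [q' Kq <-]; apply/eqP; rewrite -mulrBl => pq.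
  apply: nv; exists p', q'; split => //.
  by rewrite -[RHS]mul1r -[1]/(1%:C%C) -pq divfK.
suff H i p q : L p -> L q -> p - q != (i.+1%:R : R)%:C%C.
  have /eqP := H j (z / v) (w / v) (imageP _ Kz) (imageP _ Kw); apply.
  by rewrite -mulrBl zw mulrnAl divff // rmorph_nat.
elim: i p q => [|i IH]; first exact: nL1.
by rewrite -[i.+2]addn1 natrD; apply: chord_additive => //.
Qed.
End Chains.

(** * Affine orbits, and closed conditions on digit sequences *)

Section Orbits.
Variable R : realType.
Implicit Types (c x z : R[i]) (d : nat -> R[i]).

Lemma unit_diskP z : unit_disk R z <-> cmod z < 1.
Proof. by rewrite /unit_disk /= cmodE -ltcR. Qed.

Lemma exteriorP c : exterior R c <-> 1 < cmod c.
Proof.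
rewrite /exterior /setC /=; split => [nc|c1 /closure_cmodP H].
  rewrite ltNge; apply/negP => c1; apply: nc; apply/closure_cmodP => e e0.
  pose t := Num.min (e / 2) (1 / 2).
  have t0 : 0 < t by rewrite lt_min !divr_gt0.
  have t1 : t <= 1 / 2 by rewrite ge_min lexx orbT.
  have te : t <= e / 2 by rewrite ge_min lexx.
  exists (c * (1 - t)%:C%C).
    apply/unit_diskP; rewrite cmodM cmod_real ger0_norm; last lra.
    have := cmod_ge0 c; nra.
  rewrite -{2}[c]mulr1 -mulrBr cmodM -(rmorph1 (@real_complex R)) -rmorphB cmod_real.
  rewrite addrAC subrr sub0r normrN gtr0_norm //.
  have := cmod_ge0 c; nra.
have [|w /unit_diskP w1 wc] := H (cmod c - 1); first by rewrite subr_gt0.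
have := lerB_cmod c w; rewrite cmodB; lra.
Qed.

Fixpoint orbit c d x N : R[i] :=
  if N is N'.+1 then c * orbit c d x N' + d N' else x.

Lemma orbit_ext c d d' x N : (forall k, (k < N)%N -> d k = d' k) ->
  orbit c d x N = orbit c d' x N.
Proof.
elim: N => //= N IH H; rewrite IH ?H // => k kN; apply: H; exact: ltnW.
Qed.

Lemma orbitE c d x N : c != 0 ->
  orbit c d x N = c ^+ N * (x + \sum_(k < N) d k * c ^- k.+1).
Proof.
move=> c0; elim: N => [|N IH] /=; first by rewrite big_ord0 mul1r addr0.
rewrite big_ord_recr /= addrA mulrDr IH mulrA -exprS; congr (_ + _).
by rewrite mulrCA divff ?mulr1 // expf_neq0.
Qed.

Lemma geometric_lt (B t e : R) : 0 <= t < 1 -> 0 < e ->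
  \forall N \near \oo, B * t ^+ N < e.
Proof.
move=> /andP[t0 t1] e0; have : `|t| < 1 by rewrite ger0_norm.
move=> /(cvg_geometric B)/cvgrPdist_lt/(_ e e0); apply: filterS => N /=.
rewrite sub0r normrN; exact: le_lt_trans (ler_norm _).
Qed.

Lemma orbit_bounded_cvg c d x (B : R) : 1 < cmod c ->
  (forall N, cmod (orbit c d x N) <= B) ->
  (fun N => orbit c d x N / c ^+ N) @ \oo --> (0 : R[i]).
Proof.
move=> c1 oB; apply/cvg_cmodP => e e0.
have : 0 <= (cmod c)^-1 < 1 by rewrite invr_ge0 cmod_ge0 invf_lt1 // (lt_trans ltr01).
move=> ci; have := geometric_lt B ci e0; apply: filterS => N; apply: le_lt_trans.
rewrite subr0 cmod_div cmodX exprVn ler_wpM2r // invr_ge0.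
by rewrite exprn_ge0 // cmod_ge0.
Qed.

(* Outside the disc of radius [C / (|c| - 1)] the orbit grows like [|c|^N]. *)
Lemma orbit_cvg_bounded c d x (C : R) : 1 < cmod c ->
  (forall k, cmod (d k) <= C) ->
  (fun N => orbit c d x N / c ^+ N) @ \oo --> (0 : R[i]) ->
  forall N, (cmod c - 1) * cmod (orbit c d x N) <= C.
Proof.
move=> c1 dC cv N; rewrite leNgt; apply/negP => hN.
(* The excess over the bound is multiplied by at least [|c|] at each step, so a positive excess at
   [N] keeps the normalized orbit at least [del] away from [0] from then on. *)
pose ex M := (cmod c - 1) * cmod (orbit c d x M) - C.
have exS M : cmod c * ex M <= ex M.+1.
  have := lerB_cmod (c * orbit c d x M) (- d M); rewrite opprK cmodN cmodM.
  have := dC M; rewrite /ex /=; set u := cmod (_ + _); set v := cmod (orbit _ _ _ _).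
  move: (cmod (d M)) => w; nra.
have exN k : cmod c ^+ k * ex N <= ex (k + N)%N.
  elim: k => [|k IH]; first by rewrite mul1r.
  rewrite exprS -mulrA addSn; apply: le_trans (exS _); rewrite ler_pM2l //; lra.
have eN0 : 0 < ex N by rewrite subr_gt0.
have c0 : 0 < cmod c by lra.
have C0 : 0 <= C by apply: le_trans (dC 0%N); exact: cmod_ge0.
pose del := ex N / cmod c ^+ N / (cmod c - 1).
have del0 : 0 < del by rewrite !divr_gt0 ?exprn_gt0 // subr_gt0.
have /cvg_cmodP/(_ _ del0)[M _ HM] := cv.
have /= := HM (M + N)%N (leq_addr _ _); apply/negP; rewrite -leNgt subr0.
rewrite /del ler_pdivrMr ?subr_gt0 // cmod_div cmodX ler_pdivrMr ?exprn_gt0 //.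
have -> : forall u, u / cmod c ^+ (M + N) * (cmod c - 1) * cmod c ^+ N =
    (cmod c - 1) * u / cmod c ^+ M.
  by move=> u; rewrite exprD; field; rewrite !expf_neq0 ?gt_eqF.
rewrite ler_pdivlMr ?exprn_gt0 // mulrC; apply: le_trans (exN M) _.
by rewrite /ex; lra.
Qed.

(** Projection along a compact factor is a closed map: sequences in a finite set form a compact
    product by Tychonoff, and [Q N] reads only the first [N] digits, so its failure persists near a
    sequence. *)
Lemma digit_closed (X : topologicalType) (T : choiceType) (F : set T)
    (Q : nat -> (nat -> T) -> set X) :
  finite_set F ->
  (forall N (d d' : nat -> T), (forall k, (k < N)%N -> d k = d' k) -> Q N d `<=` Q N d') ->
  (forall N (d : nat -> T), closed (Q N d)) ->
  closed [set x | exists d : nat -> T, (forall k, F (d k)) /\ forall N, Q N d x].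
Proof.
move=> fF Qext Qc; rewrite -[X in closed X]setCK; apply: open_closedC.
rewrite openE => x nx.
pose sequences := prod_topology (fun _ : nat => discrete_topology T).
pose S := [set f : sequences | forall k, F (f k)].
have /compact_near_coveringP cS : compact S.
  apply: (@tychonoff nat (fun _ => discrete_topology T) (fun _ => F)) => k.
  exact: finite_compact.
suff : nbhs x [set y | S `<=` fun f => exists N, ~ Q N f y].
  apply: filterS => y Hy [f [Sf Qf]].
  by have [N] := Hy f Sf; apply; apply: Qf.
apply: cS.
move=> f Sf; have [N nQ] : exists N, ~ Q N f x.
    by apply/existsNP => HQ; apply: nx; exists f.
  pose V := [set g : sequences | forall k, (k < N)%N -> g k = f k].
  exists (V, ~` Q N f) => /=; last first.
    move=> [g y] [/= Vg nQy]; exists N => Qy; apply: nQy.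
    by apply: Qext Qy => k /Vg.
  split; last by apply: open_nbhs_nbhs; split => //; apply: closed_openC.
  (* A cylinder is a neighbourhood, being a finite intersection of conditions on single
     coordinates. *)
  rewrite /V; elim: {nQ V} N => [|N IH].
    by apply: filterS filterT => g _ k.
  have fN : nbhs f [set g : sequences | g N = f N].
    exact: (@proj_continuous nat (fun=> discrete_topology T) N f _
      (discrete_set1 (f N))).
  apply: filterS (filterI IH fN) => g [gk gN] k.
  by rewrite ltnS leq_eqVlt => /predU1P[->|/gk].
Qed.

End Orbits.

(** * The letters [A n] and the digits [D n], their halved differences *)

Section Digits.
Variable n : nat.

Lemma A_sub s t : A n s -> A n t -> exists2 d, D n d & t - s = d * 2.
Proof.
move=> [i iN ->] [j jN ->]; exists (j%:Z - i%:Z); rewrite /D /=; lia.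
Qed.

(** One of the two letters can be the least one, [- n + 1]; the sign of [d] decides which. *)
Lemma D_sub d : D n d -> exists s t, [/\ A n s, A n t & t - s = d * 2].
Proof.
move=> /andP[d1 d2]; have [d0|d0] := leP 0 d.
  exists (- n%:Z + 1), (- n%:Z + 1 + 2 * `|d|%N%:Z); split; last lia.
  - exists 0%N; lia.
  - exists `|d|%N; lia.
exists (- n%:Z + 1 + 2 * `|d|%N%:Z), (- n%:Z + 1); split; last lia.
- exists `|d|%N; lia.
- exists 0%N; lia.
Qed.

Lemma A_le t : A n t -> `|t| <= n%:Z - 1.
Proof. move=> [j jn ->]; lia. Qed.

Lemma D_le d : D n d -> `|d| <= n%:Z - 1.
Proof. rewrite /D /=; lia. Qed.

Lemma finite_int (N : nat) (F : set int) :
  (forall d, F d -> `|d| <= N%:Z) -> finite_set F.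
Proof.
move=> FN; apply: (@sub_finite_set _ _ ((fun i : nat => i%:Z - N%:Z) @` `I_(2 * N + 1))).
  move=> d /FN dN; exists (absz (d + N%:Z)) => /=; lia.
exact/finite_image/finite_II.
Qed.

Lemma finite_D : finite_set (D n).
Proof. by apply: (@finite_int n) => d /D_le; lia. Qed.

Lemma finite_A : finite_set (A n).
Proof. by apply: (@finite_int n) => d /A_le; lia. Qed.

End Digits.

(** * The survival condition, and existence of the attractor *)

Section Survival.
Variables (R : realType) (n : nat).
Implicit Types (c x : R[i]).

Lemma cmod_digit (d : int) : `|d| <= n%:Z - 1 -> cmod (d%:~R : R[i]) <= n%:R - 1.
Proof.
by move=> h; rewrite cmod_int -intr_norm -[1]/(1%:~R) -[n%:R]/(n%:~R) -intrB ler_int.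
Qed.

(** This bound replaces convergence of the series because it is a closed condition for each [N]; the
    product form avoids dividing by [cmod c - 1]. *)
Definition survives c := exists d : nat -> int, (forall k, D n (d k)) /\
  forall N, (cmod c - 1) * cmod (orbit c (fun k => (d k)%:~R) 1 N) <= n%:R - 1.

Lemma survives_series c : 1 < cmod c -> survives c <->
  exists d : nat -> int, (forall k, (1 <= k)%N -> D n (d k)) /\
    (fun N : nat => 1 + \sum_(1 <= k < N.+1) (d k)%:~R * c ^- k : R[i])
      @ \oo --> (0 : R[i]).
Proof.
move=> c1; have c0 : c != 0 by rewrite -cmod_gt0; lra.
have E (d : nat -> int) : (fun N : nat => 1 + \sum_(1 <= k < N.+1) (d k)%:~R * c ^- k : R[i]) =
    (fun N => orbit c (fun k => (d k.+1)%:~R) 1 N / c ^+ N).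
  apply/funext => N; rewrite orbitE // mulrAC divff ?expf_neq0 // mul1r.
  by rewrite big_add1 /= big_mkord.
split=> -[d [Dd dc]].
  (* Orbit digits start at index 0 and series digits at index 1, hence the shift. *)
  exists (fun k => d k.-1); split => [k _|]; first exact: Dd.
  rewrite E /=; apply: (@orbit_bounded_cvg _ _ _ _ ((n%:R - 1) / (cmod c - 1))) => // N.
  by rewrite ler_pdivlMr ?subr_gt0 // mulrC.
exists (fun k => d k.+1); split => [k|]; first exact: Dd.
apply: orbit_cvg_bounded => //; last by rewrite -E.
by move=> k; apply: cmod_digit; apply: D_le; apply: Dd.
Qed.

Lemma continuousMDcst (f g : R[i] -> R[i]) (a : R[i]) :
  continuous f -> continuous g -> continuous (fun z => f z * g z + a).
Proof.
move=> cf cg z.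
apply: (@continuousD R[i] R[i]^o R[i] (fun z => f z * g z) (fun=> a)).
  by apply: (@continuousM R[i]); [exact: cf|exact: cg].
exact: cst_continuous.
Qed.

Lemma closed_survives : closed [set c | survives c].
Proof.
apply: digit_closed (finite_D n) _ _ => [N d d' dd' c /=|N d].
  by rewrite (@orbit_ext _ _ _ (fun k => (d' k)%:~R)) // => k /dd' ->.
pose f c := (cmod c - 1) * cmod (orbit c (fun k => (d k)%:~R) 1 N).
suff cf : continuous f.
  by move/continuous_closedP : cf => /(_ _ (@closed_le R (n%:R - 1))).
have co : continuous (fun c => orbit c (fun k => (d k)%:~R) 1 N).
  elim: N {f} => [|N IH] c; first exact: cst_continuous.
  by apply: (continuousMDcst (f := id)); [move=> ?; exact: cvg_id|exact: IH].
move=> c; apply: (@continuousM R _ (fun c => cmod c - 1) (fun c => cmod (orbit c _ 1 N))).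
  apply: (@continuousB R R^o _ (@cmod R) (fun=> 1)); first exact: cmod_continuous.
  exact: cst_continuous.
by apply: (@continuous_comp _ _ _ (fun c => orbit c _ 1 N) (@cmod R)); [exact: co|exact: cmod_continuous].
Qed.

Lemma orbitS c d x N : orbit c d x N.+1 = orbit c (fun k => d k.+1) (c * x + d 0%N) N.
Proof. by elim: N => //= N <-. Qed.

(** One step is [x |-> c * (x - a k)], the inverse of [ifs_map c (a k)], so the results on [orbit]
    apply to backward orbits. *)
Definition address_orbit c (a : nat -> int) x := orbit c (fun k => - (c * (a k)%:~R)) x.

(** The attractor consists of the points with an address whose backward orbit stays in a fixed disc.
    Removing or prepending a letter gives self-similarity, and [digit_closed] gives closedness. *)
Lemma attractor_exists c : (1 <= n)%N -> 1 < cmod c -> exists K, is_attractor c n K.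
Proof.
move=> n0 c1; have c0 : c != 0 by rewrite -cmod_gt0; lra.
have n1 : 1 <= n%:R :> R by rewrite ler1n.
(* The solution of [n - 1 + B / |c| = B]: every map sends the disc of radius [B] into itself. *)
pose B := (n%:R - 1) * cmod c / (cmod c - 1).
have BE : n%:R - 1 + B / cmod c = B.
  by rewrite /B; field; rewrite cmod_eq0 c0 subr_eq0 gt_eqF.
pose E := [set x | exists a : nat -> int, (forall k, A n (a k)) /\
  forall N, cmod (address_orbit c a x N) <= B].
have EE : E = \bigcup_(t in A n) (ifs_map c t @` E).
  apply/seteqP; split => [x [a [Aa aB]]|x [t At [y [a [Aa aB]] <-]]].
    exists (a 0%N) => //; exists (c * x - c * (a 0%N)%:~R); last first.
      by rewrite /ifs_map mulrBl [c * x]mulrC [c * _%:~R]mulrC !mulfK // addrCA subrr addr0.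
    exists (fun k => a k.+1); split => // N.
    by have := aB N.+1; rewrite /address_orbit orbitS.
  exists (fun k => if k is k'.+1 then a k' else t); split => [[]//|[|N]] /=.
    apply: le_trans (ler_cmodD _ _) _; rewrite -[leRHS]BE cmod_div lerD //.
      exact/cmod_digit/A_le.
    by rewrite ler_wpM2r ?invr_ge0 ?cmod_ge0 //; apply: (aB 0%N).
  rewrite /address_orbit orbitS /=.
  suff -> : c * ifs_map c t y - c * t%:~R = y by apply: aB.
  by rewrite /ifs_map mulrDr addrAC subrr add0r mulrCA divff ?mulr1.
exists E; split => //.
(* The fixed point of [ifs_map c t] has a constant backward orbit. *)
- pose t : int := - n%:Z + 1; have At : A n t by exists 0%N => //; rewrite mulr0 addr0.
  have c10 : c - 1 != 0.
    by apply: contraTneq c1 => /eqP; rewrite subr_eq0 => /eqP ->; rewrite cmod1 ltxx.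
  pose x := t%:~R * c / (c - 1); exists x; exists (fun=> t); split => // N.
  have -> : address_orbit c (fun=> t) x N = x.
    elim: N => //= N; rewrite /address_orbit /= => ->; rewrite /x; field.
    exact: c10.
  rewrite /x /B !cmod_div cmodM ler_pM ?mulr_ge0 ?invr_ge0 ?cmod_ge0 //.
    by rewrite ler_wpM2r ?cmod_ge0 //; exact/cmod_digit/A_le.
  rewrite lef_pV2 ?posrE ?cmod_gt0 ?subr_gt0 //.
  by have := lerB_cmod c 1; rewrite cmod1.
- apply: subclosed_compact (@compact_box R B) _; last first.
    move=> x [a [_ aB]]; have := aB 0%N; rewrite /= => xB.
    by split; [apply: le_trans (ler_Re_cmod _) xB|apply: le_trans (ler_Im_cmod _) xB].
  apply: digit_closed (finite_A n) _ _ => [N a a' aa' x /=|N a].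
    by rewrite /address_orbit (@orbit_ext _ _ _ (fun k => - (c * (a' k)%:~R))) // => k /aa' ->.
  pose f x := cmod (address_orbit c a x N).
  suff cf : continuous f.
    by move/continuous_closedP : cf => /(_ _ (@closed_le R B)).
  have co : continuous (fun x => address_orbit c a x N).
    elim: N {f} => [|N IH] x; first exact: cvg_id.
    by apply: (continuousMDcst (f := fun=> c)); [exact: cst_continuous|exact: IH].
  by move=> x; apply: (@continuous_comp _ _ _ (fun x => address_orbit c a x N) (@cmod R)); [exact: co|exact: cmod_continuous].
Qed.

End Survival.

(** * Connectedness of an attractor and its chord [2 c] *)

Section Attractors.
Variables (R : realType) (n : nat) (c : R[i]) (K : set R[i]).
Hypotheses (n1 : (1 < n)%N) (c1 : 1 < cmod c) (attrK : is_attractor c n K).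

Let K0 : K !=set0. Proof. by case: attrK. Qed.
Let cK : compact K. Proof. by case: attrK. Qed.
Let KE : K = \bigcup_(t in A n) (ifs_map c t @` K). Proof. by case: attrK. Qed.

Let c0 : c != 0. Proof. by rewrite -cmod_gt0 (lt_trans ltr01). Qed.

Lemma ifs_map_continuous t : continuous (ifs_map c t).
Proof.
have -> : ifs_map c t = (fun z => z * c^-1 + t%:~R).
  by apply/funext => z; rewrite /ifs_map addrC.
apply: (continuousMDcst (f := id)) => [z|]; first exact: cvg_id.
exact: cst_continuous.
Qed.

Lemma attractor_map t x : A n t -> K x -> K (ifs_map c t x).
Proof. by move=> At Kx; rewrite KE; exists t => //; exists x. Qed.

Lemma attractor_address x : K x ->
  exists a : nat -> int, (forall k, A n (a k)) /\
    forall N, K (address_orbit c a x N).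
Proof.
move=> Kx; have /choice[f Hf] : forall y, exists t, K y -> A n t /\ K (c * (y - t%:~R)).
  move=> y; have [Ky|nKy] := pselect (K y); last by exists 0.
  move: (Ky); rewrite {1}KE => -[t At [z Kz zy]]; exists t => _; split => //.
  suff -> : c * (y - t%:~R) = z by [].
  by rewrite -zy /ifs_map addrAC subrr add0r mulrCA divff ?mulr1.
pose y := fix y N := if N is N'.+1 then c * (y N' - (f (y N'))%:~R) else x.
have Ky N : K (y N) by elim: N => //= N /Hf[].
exists (f \o y); split => [k|N]; first by case: (Hf _ (Ky k)).
suff -> : address_orbit c (f \o y) x N = y N by [].
by rewrite /address_orbit; elim: N => //= N ->; rewrite mulrBr.
Qed.

(** This point is the image of [y] under the composite of the maps labelled [a 0], ..., [a (N - 1)],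
    with [a 0] outermost. *)
Lemma attractor_prefix (a : nat -> int) N y : (forall k, A n (a k)) -> K y ->
  K (\sum_(k < N) (a k)%:~R * c ^- k + y * c ^- N).
Proof.
move=> Aa; elim: N y => [|N IH] y Ky; first by rewrite big_ord0 add0r expr0 invr1 mulr1.
rewrite big_ord_recr /= -addrA.
have -> : (a N)%:~R * c ^- N + y * c ^- N.+1 = ifs_map c (a N) y * c ^- N.
  by rewrite /ifs_map mulrDl -mulrA -invfM -exprS.
by apply: IH; apply: attractor_map.
Qed.

(** The difference of two backward orbits, divided by [2 c], is the orbit of [1] with digits
    [(b k - a k) / 2], and it is bounded because [K] is. *)
Lemma chord_survives x y : K x -> K y -> x - y = c * 2 -> survives n c.
Proof.
move=> Kx Ky xy; have [a [Aa Ka]] := attractor_address Kx.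
have [b [Ab Kb]] := attractor_address Ky.
have /choice[d Hd] : forall k, exists d, D n d /\ b k - a k = d * 2.
  by move=> k; have [d Dd] := A_sub (Aa k) (Ab k); exists d.
have c20 : c * 2 != 0 by rewrite mulf_neq0 // pnatr_eq0.
have E N : orbit c (fun k => (d k)%:~R) 1 N =
    (address_orbit c a x N - address_orbit c b y N) / (c * 2).
  elim: N => [|N IH] /=; first by rewrite xy divff.
  have bad : (b N)%:~R - (a N)%:~R = (d N)%:~R * 2 :> R[i].
    by rewrite -[2]/(2%:~R) -intrM -rmorphB; have [_ ->] := Hd N.
  rewrite IH; have -> : (d N)%:~R = ((b N)%:~R - (a N)%:~R) / 2 :> R[i].
    by rewrite bad mulfK // pnatr_eq0.
  rewrite /address_orbit /=; field; exact: c0.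
have [M _ KM] : exists2 M, K M & forall z, K z -> cmod z <= cmod M.
  have cc : {within K, continuous (@cmod R)}.
    by apply: continuous_subspaceT; exact: cmod_continuous.
  have [M /set_mem KM HM] := compact_EVT_max K0 cK cc.
  by exists M => // z Kz; apply: HM; rewrite inE.
exists d; split => [k|]; first by case: (Hd k).
(* Any bound on the orbit gives convergence, which in turn gives the sharp bound. *)
apply: orbit_cvg_bounded => // [k|].
  by apply/cmod_digit/D_le; case: (Hd k).
apply: (@orbit_bounded_cvg _ _ _ _ ((cmod M + cmod M) / cmod (c * 2))) => // N.
rewrite E cmod_div ler_wpM2r ?invr_ge0 ?cmod_ge0 //.
by apply: le_trans (ler_cmodB _ _) (lerD _ _); apply: KM.
Qed.

(** Writing each digit as a halved difference of letters yields pairs of points of [K] whose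
    difference misses [2 c] by [2 c] times the normalized orbit, which tends to [0]; the difference
    set of [K] is closed. *)
Lemma survives_chord : survives n c -> exists x y, [/\ K x, K y & x - y = c * 2].
Proof.
move=> [d [Dd Hd]].
have /choice[a Ha] : forall k, exists s : int * int, [/\ A n s.1, A n s.2 & s.2 - s.1 = d k * 2].
  by move=> k; have [s [t st]] := D_sub (Dd k); exists (s, t).
have [y Ky] := K0.
have /closure_id E := compact_closedC (compact_diff cK).
suff : closure [set p.1 - p.2 | p in K `*` K] (c * 2).
  by rewrite -E => -[[p q] /= [Kp Kq] pq]; exists p, q.
have c20 : 0 < cmod (c * 2) by rewrite cmod_gt0 mulf_neq0 // pnatr_eq0.
apply/closure_cmodP => e e0.
have cv : (fun N => orbit c (fun k => (d k)%:~R) 1 N / c ^+ N) @ \oo --> (0 : R[i]).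
  apply: (@orbit_bounded_cvg _ _ _ _ ((n%:R - 1) / (cmod c - 1))) => // N.
  by rewrite ler_pdivlMr ?subr_gt0 // mulrC.
have /cvg_cmodP/(_ (e / cmod (c * 2))) := cv.
rewrite divr_gt0 // => /(_ isT)[N _ /(_ N (leqnn _))] /=.
rewrite subr0 ltr_pdivlMr // -cmodM => HN.
pose u (b : nat -> int) := \sum_(k < N) (b k)%:~R * c ^- k + y * c ^- N.
exists (u (fun k => (a k).1) - u (fun k => (a k).2)).
  exists (u (fun k => (a k).1), u (fun k => (a k).2)) => //.
  by split; apply: attractor_prefix => // k; case: (Ha k).
rewrite -cmodN; apply: le_lt_trans HN; rewrite orbitE //.
rewrite [c ^+ N * _]mulrC mulfK ?expf_neq0 // mulrDl mul1r !opprB.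
rewrite le_eqVlt; apply/orP; left; apply/eqP; congr cmod.
congr (_ + _); rewrite /u opprD addrACA subrr addr0.
rewrite -sumrB mulr_suml; apply: eq_bigr => k _.
have [_ _ Hk] := Ha k.
have -> : (d k)%:~R * c ^- k.+1 * (c * 2) = (d k * 2)%:~R * c ^- k :> R[i].
  rewrite intrM exprSr invfM; field; rewrite expf_neq0 //.
by rewrite -Hk rmorphB mulrBl.
Qed.

Lemma connected_attractor_survives : connected K -> survives n c.
Proof.
move=> nK; pose t0 : int := - n%:Z + 1.
have At0 : A n t0 by exists 0%N; [exact: ltnW|rewrite mulr0 addr0].
pose U := ifs_map c t0 @` K.
(* The piece of the least letter and the union of the others are closed and cover [K], so
   connectedness makes them meet. *)
pose V := \bigcup_(t in A n `\ t0) (ifs_map c t @` K).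
have KUV : K = U `|` V.
  rewrite {1}KE; apply/seteqP; split => [x [t At tx]|x [Ux|[t [At _] tx]]].
  - by have [tt0|tt0] := eqVneq t t0; [left; rewrite /U -tt0|right; exists t => //; split => //; apply/eqP].
  - by exists t0.
  - by exists t.
have clf t : closed (ifs_map c t @` K).
  apply: compact_closedC; apply: continuous_compact => //.
  by apply: continuous_subspaceT; exact: ifs_map_continuous.
have clV : closed V.
  apply: closed_bigcup => //; apply: sub_finite_set (finite_A n); exact: subDsetl.
have [z Kz] := K0.
have [[x [Ux Vx]]|UV0] := pselect (U `&` V !=set0); last first.
  have UK : U = K.
    apply: nK; first by exists (ifs_map c t0 z); exists z.
    - exists (~` V); first exact: closed_openC.
      rewrite KUV; apply/seteqP; split => x; last by case=> -[].
      by move=> Ux; split; [left|move=> Vx; apply: UV0; exists x].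
    - by exists U; [exact: clf|rewrite KUV setUK].
  (* A second letter exists as [n >= 2]; its piece lies in [V] and in [K = U]. *)
  exfalso; apply: UV0; pose t1 : int := - n%:Z + 3.
  exists (ifs_map c t1 z); rewrite UK.
  have At1 : A n t1 by exists 1%N => //; rewrite /t1; lia.
  split; first exact: attractor_map.
  by exists t1; [split => //; rewrite /t1 /t0 /=; lia|exists z].
case: Ux Vx => [p Kp <-] [t [At /eqP tt0] [q Kq E]].
have [j jn tE] := At; case: j jn tE => [|j] jn tE.
  by move: tt0; rewrite tE mulr0 addr0 eqxx.
(* Here [t - t0 = 2 * j.+1], so the common point gives the chord [j.+1] times [2 c]. *)
have [v [w [Kv Kw vw]]] : exists v w, [/\ K v, K w & v - w = c * 2].
  apply: (@chord_divide _ _ _ j) => //; exists p, q; split => //.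
  have -> : p - q = c * (t - t0)%:~R.
    rewrite rmorphB /=; move: E; rewrite /ifs_map => /(canRL (addKr _)).
    move=> /(canRL (mulfVK c0)) ->; field; exact: c0.
  by rewrite tE /t0 addrAC subrr add0r intrM mulrA -[RHS]mulr_natr.
exact: chord_survives vw.
Qed.

(** The chord [p - q = 2 c] makes consecutive pieces share a point. Inductively, chains at scale
    [M * r ^+ m] inside [K] are contracted into the pieces and concatenated there. *)
Lemma survives_connected_attractor : survives n c -> connected K.
Proof.
move=> /survives_chord[p [q [Kp Kq pq]]].
pose r := (cmod c)^-1; have r01 : 0 <= r < 1.
  by rewrite invr_ge0 cmod_ge0 invf_lt1 // (lt_trans ltr01).
have [M KM] : exists M, forall z w, K z -> K w -> cmod (w - z) <= M.
  have cc : {within K, continuous (@cmod R)}.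
    by apply: continuous_subspaceT; exact: cmod_continuous.
  have [M /set_mem KM HM] := compact_EVT_max K0 cK cc.
  exists (cmod M + cmod M) => z w Kz Kw; apply: le_trans (ler_cmodB _ _) _.
  by apply: lerD; apply: HM; rewrite inE.
pose t (j : nat) : int := - n%:Z + 1 + 2 * j%:Z.
have At j : (j < n)%N -> A n (t j) by move=> jn; exists j.
have link j : ifs_map c (t j) p = ifs_map c (t j.+1) q.
  rewrite /ifs_map -[p](subrK q) pq mulrDl addrA; congr (_ + _).
  have -> : t j.+1 = t j + 2 by rewrite /t; lia.
  by rewrite intrD [c * 2]mulrC mulfK.
have chain m z w : K z -> K w -> chained K (M * r ^+ m) z w.
  elim: m z w => [|m IH] z w Kz Kw.
    by apply: chained1 => //; rewrite expr0 mulr1; apply: KM.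
  have piece j z' w' : (j < n)%N -> K z' -> K w' ->
      chained K (M * r ^+ m.+1) (ifs_map c (t j) z') (ifs_map c (t j) w').
    move=> jn Kz' Kw'; apply: chained_image (IH _ _ Kz' Kw').
      by move=> u; apply: attractor_map; apply: At.
    move=> u v uv; rewrite /ifs_map opprD addrACA subrr add0r -mulrBl cmod_div.
    by rewrite exprSr mulrA ler_wpM2r //; case/andP: r01.
  have reach j z' w' : (j < n)%N -> K z' -> K w' ->
      chained K (M * r ^+ m.+1) (ifs_map c (t 0%N) z') (ifs_map c (t j) w').
    elim: j w' => [|j IHj] w' jn Kz' Kw'; first exact: piece.
    apply: chained_trans (IHj p (ltnW jn) Kz' Kp) _.
    by rewrite link; apply: piece.
  (* Both points are joined to [ifs_map c (t 0) p]. *)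
  move: Kz Kw; rewrite {1 2}KE => -[_ [i iN ->] [z' Kz' <-]] [_ [j jN ->] [w' Kw' <-]].
  apply: chained_trans (reach j p w' jN Kp Kw').
  apply: chained_sym; last exact: reach.
  by apply: attractor_map => //; apply: At; apply: ltnW.
apply: chained_connected => // e z w e0 Kz Kw.
have [m _ /(_ m (leqnn m)) /= /ltW Hm] := geometric_lt M r01 e0.
have [s ps <-] := chain m z w Kz Kw; exists s => //.
by apply: sub_path ps => u v /asboolP[Kv uv]; apply/asboolP; split => //; apply: le_trans uv Hm.
Qed.

End Attractors.

(** * Counting zeros of power series with bounded coefficients *)

Section PowerSeriesZeros.
Variable R : realType.
Implicit Types (a : nat -> R[i]) (z : R[i]) (s : seq R[i]).

Definition psum a z N : R[i] := \sum_(k < N) a k * z ^+ k.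

Definition vanishes a z := psum a z @ \oo --> (0 : R[i]).

Lemma psumS a z N : psum a z N.+1 = psum a z N + a N * z ^+ N.
Proof. by rewrite /psum big_ord_recr. Qed.

(** The tail [T] of the geometric majorant satisfies [T k = B t^k + T k.+1], so [|psum a z k| - T k]
    is nondecreasing in [k]. *)
Lemma psum_tail a z (B t : R) N M : 0 <= B -> 0 <= t < 1 ->
  (forall k, cmod (a k * z ^+ k) <= B * t ^+ k) -> (N <= M)%N ->
  cmod (psum a z N) <= cmod (psum a z M) + B * t ^+ N / (1 - t).
Proof.
move=> B0 /andP[t0 t1] aB /subnK <-; pose T k := B * t ^+ k / (1 - t).
have T0 k : 0 <= T k by rewrite divr_ge0 ?mulr_ge0 ?exprn_ge0 // subr_ge0 ltW.
have TS k : T k = B * t ^+ k + T k.+1.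
  by rewrite /T exprS; field; rewrite subr_eq0 gt_eqF.
suff H k : cmod (psum a z N) - T N <= cmod (psum a z (k + N)%N) - T (k + N)%N.
  have := H (M - N)%N; have := T0 (M - N + N)%N; rewrite /T; lra.
elim: k => // k IH; apply: le_trans IH _; rewrite addSn psumS (TS (k + N)%N).
have := lerB_cmod (psum a z (k + N)) (- (a (k + N)%N * z ^+ (k + N))).
rewrite opprK cmodN; have := aB (k + N)%N; lra.
Qed.

Lemma vanishes_tail a z (B t : R) N : 0 <= B -> 0 <= t < 1 ->
  (forall k, cmod (a k * z ^+ k) <= B * t ^+ k) -> vanishes a z ->
  cmod (psum a z N) <= B * t ^+ N / (1 - t).
Proof.
move=> B0 t01 aB /cvg_cmodP van; apply/ler_addgt0Pr => e e0.
have [M _ HM] := van e e0.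
have := HM (M + N)%N (leq_addr _ _); rewrite /= subr0 => HMN.
have := psum_tail B0 t01 aB (leq_addl M N); lra.
Qed.

Lemma cmod_sqr z : cmod z ^+ 2 = complex.Re z ^+ 2 + complex.Im z ^+ 2.
Proof.
by rewrite /cmod normc_def /= sqr_sqrtr // addr_ge0 // sqr_ge0.
Qed.

(** A coefficientwise form of the fact that a Blaschke factor has modulus 1 on the unit circle; the
    correction term telescopes when summed. *)
Lemma blaschke_identity (x u v : R[i]) :
  cmod (v - x^*%C * u) ^+ 2 =
  cmod (u - x * v) ^+ 2 + (1 - cmod x ^+ 2) * (cmod v ^+ 2 - cmod u ^+ 2).
Proof.
rewrite !cmod_sqr; case: x u v => [x1 x2] [u1 u2] [v1 v2] /=; ring.
Qed.

Lemma cmod_conj z : cmod z^*%C = cmod z.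
Proof. by rewrite /cmod normcJ. Qed.

(* Division by the Blaschke factor [(w - x) / (1 - conj(x) w)] preserves the
   l2-norm of the coefficients. *)
Lemma blaschke_step a x (B t S : R) : 0 < cmod x < 1 -> 0 <= B -> 0 <= t < 1 ->
  (forall k, cmod (a k) <= B * t ^+ k) ->
  (forall N, \sum_(k < N) cmod (a k) ^+ 2 <= S) -> vanishes a x ->
  exists h : nat -> R[i],
  [/\ exists2 B', 0 <= B' & forall k, cmod (h k) <= B' * t ^+ k,
      forall N, \sum_(k < N) cmod (h k) ^+ 2 <= S,
      cmod (a 0%N) = cmod x * cmod (h 0%N) &
      forall z, z != x -> cmod z < 1 -> vanishes a z -> vanishes h z].
Proof.
move=> /andP[x0 x1] B0 /andP[t0 t1] aB aS ax.
have xn0 : x != 0 by rewrite -cmod_gt0.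
(* [G k.+1] is the coefficient of [w^k] in [a(w) / (w - x)]. Since [a] vanishes at [x], these
   partial sums are tails, so [G] decays at the rate [t] of [a]. *)
pose G k := - (psum a x k / x ^+ k).
have GS k : a k = G k - x * G k.+1.
  by rewrite /G psumS exprS; field; rewrite expf_neq0 ?xn0.
have tx : 0 <= t * cmod x < 1.
  rewrite mulr_ge0 ?cmod_ge0 //=; nra.
pose B1 := B / (1 - t * cmod x).
have B10 : 0 <= B1.
  by rewrite divr_ge0 // subr_ge0; case/andP: tx => _ /ltW.
have GB k : cmod (G k) <= B1 * t ^+ k.
  have H := @vanishes_tail a x B (t * cmod x) k B0 tx _ ax.
  rewrite /G cmodN cmod_div cmodX ler_pdivrMr ?exprn_gt0 //.
  apply: le_trans (H _) _.
    move=> j; rewrite cmodM cmodX exprMn mulrA ler_wpM2r ?exprn_ge0 ?cmod_ge0 //.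
  by rewrite /B1 exprMn le_eqVlt; apply/orP; left; apply/eqP; ring.
have G0 : G 0%N = 0 by rewrite /G /psum big_ord0 mul0r oppr0.
pose h k := G k.+1 - x^*%C * G k.
exists h; split.
- exists (2 * B1) => [|k]; first by rewrite mulr_ge0.
  apply: le_trans (ler_cmodB _ _) _; rewrite cmodM cmod_conj.
  have := GB k; have := GB k.+1; rewrite exprS.
  have : 0 <= B1 * t ^+ k by rewrite mulr_ge0 // exprn_ge0.
  move: (cmod_ge0 (G k)); move: (cmod (G k)) (cmod (G k.+1)) (t ^+ k) => u v w; nra.
(* The truncated norms differ by one boundary term, which tends to [0]. *)
- have hS N : \sum_(k < N) cmod (h k) ^+ 2 =
      \sum_(k < N) cmod (a k) ^+ 2 + (1 - cmod x ^+ 2) * cmod (G N) ^+ 2.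
    elim: N => [|N IH]; first by rewrite !big_ord0 G0 cmod0 expr0n mulr0 addr0.
    rewrite !big_ord_recr /= IH /h blaschke_identity -GS; ring.
  have mono N M : \sum_(k < N) cmod (h k) ^+ 2 <= \sum_(k < M + N) cmod (h k) ^+ 2.
    elim: M => // M IH; rewrite addSn big_ord_recr /=; apply: le_trans IH _.
    by rewrite lerDl sqr_ge0.
  move=> N; apply/ler_addgt0Pr => e e0.
  have t2 : 0 <= t ^+ 2 < 1 by rewrite sqr_ge0 expr_lt1.
  have [M _ HM] := geometric_lt (B1 ^+ 2) t2 e0.
  have := HM (M + N)%N (leq_addr _ _); rewrite /= => HMN.
  apply: le_trans (mono N M) _; rewrite hS lerD //.
  apply: le_trans (ltW HMN); rewrite -exprM mulnC exprM -exprMn.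
  have : cmod (G (M + N)%N) ^+ 2 <= (B1 * t ^+ (M + N)) ^+ 2.
    by apply: lerXn2r (GB _); rewrite nnegrE ?cmod_ge0 // mulr_ge0 ?exprn_ge0.
  have := sqr_ge0 (cmod (G (M + N)%N)); have := sqr_ge0 (cmod x); nra.
- by rewrite GS G0 sub0r cmodN cmodM /h G0 mulr0 subr0.
- move=> z zx z1 az.
  (* Multiplying back by the Blaschke factor, up to a boundary term that tends to [0]. *)
  have E N : (z - x) * psum h z N =
      (1 - x^*%C * z) * psum a z N + (1 - x^*%C * x) * G N * z ^+ N.
    elim: N => [|N IH]; first by rewrite /psum !big_ord0 G0; ring.
    by rewrite !psumS mulrDr IH /h GS exprS; ring.
  have zx0 : 0 < cmod (z - x) by rewrite cmod_gt0 subr_eq0.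
  apply/cvg_cmodP => e e0; pose e' := e * cmod (z - x) / 4.
  have e'0 : 0 < e' by rewrite divr_gt0 // mulr_gt0.
  have t01 : 0 <= t < 1 by rewrite t0.
  have := geometric_lt B1 t01 e'0; apply: filter_app.
  have /cvg_cmodP/(_ _ e'0) := az; apply: filterS => N; rewrite !subr0 => aN GN.
  rewrite -(ltr_pM2l zx0) -cmodM E; apply: le_lt_trans (ler_cmodD _ _) _.
  have c2 (u v : R[i]) : cmod u <= 1 -> cmod v <= 1 -> cmod (1 - u^*%C * v) <= 2.
    move=> u1 v1; apply: le_trans (ler_cmodB _ _) _; rewrite cmod1 cmodM cmod_conj.
    have := cmod_ge0 u; have := cmod_ge0 v; nra.
  have h1 := c2 _ _ (ltW x1) (ltW z1); have h2 := c2 _ _ (ltW x1) (ltW x1).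
  have h3 : cmod z ^+ N <= 1 by rewrite exprn_ile1 ?cmod_ge0 ?ltW.
  have h4 : cmod (G N) < e' by apply: le_lt_trans (GB N) GN.
  rewrite !cmodM cmodX.
  have h5 := cmod_ge0 (psum a z N); have h6 := cmod_ge0 (G N).
  have h7 : 0 <= cmod z ^+ N by rewrite exprn_ge0 ?cmod_ge0.
  have p1 : cmod (1 - x^*%C * z) * cmod (psum a z N) <= 2 * cmod (psum a z N).
    by rewrite ler_wpM2r.
  have p2 : cmod (1 - x^*%C * x) * cmod (G N) * cmod z ^+ N <= 2 * cmod (G N) * 1.
    by rewrite ler_pM ?mulr_ge0 ?cmod_ge0 // ler_wpM2r.
  have : cmod (z - x) * e = 4 * e' by rewrite /e'; field.
  lra.
Qed.

(** Each zero divided out costs the constant term a factor of modulus at most [q], while the last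
    constant term is still bounded by the l2-norm. *)
Lemma zeros_product_bound s a (B t q S : R) : 0 <= B -> 0 <= t < 1 -> q < 1 ->
  (forall k, cmod (a k) <= B * t ^+ k) ->
  (forall N, \sum_(k < N) cmod (a k) ^+ 2 <= S) ->
  uniq s -> {in s, forall x, [/\ 0 < cmod x, cmod x <= q & vanishes a x]} ->
  cmod (a 0%N) ^+ 2 <= (q ^+ 2) ^+ size s * S.
Proof.
move=> B0 t01 q1; elim: s a B B0 => [|x s IH] a B B0 aB aS /=.
  by move=> _ _; have := aS 1%N; rewrite big_ord1 mul1r.
move=> /andP[xs us] H; have [x0 xq ax] := H x (mem_head _ _).
have x01 : 0 < cmod x < 1 by rewrite x0 (le_lt_trans xq).
have [h [[B' B'0 hB] hS -> hz]] := blaschke_step x01 B0 t01 aB aS ax.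
have {}IH := IH h B' B'0 hB hS us.
rewrite exprMn [q ^+ 2 ^+ _]exprS -mulrA ler_pM ?sqr_ge0 //.
  by rewrite lerXn2r ?nnegrE ?cmod_ge0 // (le_trans (ltW x0)).
apply: IH => y ys; have [|y0 yq ay] := H y; first by rewrite inE ys orbT.
split => //; apply: hz => //; last exact: le_lt_trans yq q1.
by apply: contraNneq xs => <-.
Qed.

(** Rescaling the variable by [t] with [r < t < 1] makes the coefficients square summable and moves
    the zeros into the disc of radius [q = r / t < 1]; too many of them would make the constant term
    too small. *)
Lemma finitely_many_zeros a (B r : R) : 0 <= r < 1 ->
  (forall k, cmod (a k) <= B) -> a 0%N != 0 ->
  exists N : nat, forall s, uniq s ->
    {in s, forall x, [/\ 0 < cmod x, cmod x <= r & vanishes a x]} ->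
    (size s < N)%N.
Proof.
move=> /andP[r0 r1] aB a0; have B0 : 0 <= B by apply: le_trans (aB 0%N); exact: cmod_ge0.
pose t := (1 + r) / 2; have t0 : 0 < t by rewrite /t; lra.
have t1 : t < 1 by rewrite /t; lra.
pose q := r / t; have q0 : 0 <= q by rewrite divr_ge0 // ltW.
have q1 : q < 1 by rewrite ltr_pdivrMr // mul1r /t; lra.
pose b k := a k * t%:C%C ^+ k.
have tn0 : t%:C%C != 0 :> R[i] by rewrite -cmod_gt0 cmod_real gtr0_norm.
have bB k : cmod (b k) <= B * t ^+ k.
  rewrite cmodM cmodX cmod_real (gtr0_norm t0).
  by rewrite ler_wpM2r // exprn_ge0 ?(ltW t0).
pose S := B ^+ 2 / (1 - t ^+ 2).
have t2 : t ^+ 2 < 1 by rewrite expr_lt1 // ltW.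
have bS N : \sum_(k < N) cmod (b k) ^+ 2 <= S.
  suff : \sum_(k < N) cmod (b k) ^+ 2 <= B ^+ 2 * (1 - (t ^+ 2) ^+ N) / (1 - t ^+ 2).
    move=> H; apply: le_trans H _; rewrite ler_wpM2r ?invr_ge0 ?subr_ge0 ?(ltW t2) //.
    by rewrite ler_piMr ?sqr_ge0 // gerBl exprn_ge0 // sqr_ge0.
  elim: N => [|N IH]; first by rewrite big_ord0 subrr mulr0 mul0r.
  rewrite big_ord_recr /=.
  have : cmod (b N) ^+ 2 <= B ^+ 2 * (t ^+ 2) ^+ N.
    rewrite -exprM mulnC exprM -exprMn lerXn2r ?nnegrE ?cmod_ge0 //.
    by rewrite mulr_ge0 // exprn_ge0 // ltW.
  have -> : B ^+ 2 * (1 - (t ^+ 2) ^+ N.+1) / (1 - t ^+ 2) =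
      B ^+ 2 * (1 - (t ^+ 2) ^+ N) / (1 - t ^+ 2) + B ^+ 2 * (t ^+ 2) ^+ N.
    by rewrite [t ^+ 2 ^+ N.+1]exprS; field; rewrite subr_eq0 gt_eqF.
  lra.
have qq : 0 <= q ^+ 2 < 1 by rewrite sqr_ge0 expr_lt1.
have a00 : 0 < cmod (a 0%N) ^+ 2 by rewrite exprn_gt0 // cmod_gt0.
have [N _ HN] := geometric_lt S qq a00.
exists N => s us Hs; rewrite ltnNge; apply/negP => /HN /=.
apply/negP; rewrite -leNgt mulrC.
have -> : cmod (a 0%N) = cmod (b 0%N) by rewrite /b mulr1.
have t01 : 0 <= t < 1 by rewrite ltW.
rewrite -(size_map (fun x => x / t%:C%C)).
apply: (zeros_product_bound B0 t01 q1 bB bS).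
  by rewrite map_inj_uniq // => x y /(mulIf _); apply; rewrite invr_neq0.
move=> _ /mapP[x xs ->]; have [x0 xr ax] := Hs x xs.
rewrite cmod_div cmod_real (gtr0_norm t0); split.
- by rewrite divr_gt0.
- by rewrite ler_wpM2r // invr_ge0 ltW.
- rewrite /vanishes; have -> // : psum b (x / t%:C%C) = psum a x.
  apply/funext => M; apply: eq_bigr => k _.
  by rewrite /b -mulrA -exprMn mulrCA divff // mulr1.
Qed.

End PowerSeriesZeros.

(** * A minimum modulus principle for polynomials *)

Section MinimumModulus.
Variable R : realType.

Lemma prod_le_exists (T : eqType) (s : seq T) (f : T -> R) (x : R) :
  0 <= x -> (0 < size s)%N -> \prod_(t <- s) f t <= x ^+ size s ->
  exists2 t, t \in s & f t <= x.
Proof.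
move=> x0 s0 H; apply: contrapT => nex.
have fx t : t \in s -> x < f t.
  by move=> ts; rewrite ltNge; apply/negP => ftx; apply: nex; exists t.
suff : x ^+ size s < \prod_(t <- s) f t by rewrite ltNge H.
case: s s0 fx {H nex} => // t0 s _; elim: s t0 => [|t1 s IH] t0 fx.
  by rewrite big_seq1 expr1; apply: fx; rewrite inE.
rewrite big_cons exprS; apply: ltr_pM => //; first exact: exprn_ge0.
- by apply: fx; rewrite mem_head.
- by apply: IH => t ts; apply: fx; rewrite inE ts orbT.
Qed.

Lemma size_prod_roots (P : {poly R[i]}) (rs : seq R[i]) : P != 0 ->
  P = lead_coef P *: \prod_(r <- rs) ('X - r%:P) -> size P = (size rs).+1.
Proof.
move=> P0 ->; rewrite size_scale ?lead_coef_eq0 //.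
exact: size_prod_XsubC.
Qed.

Lemma horner_roots (k : R[i]) (rs : seq R[i]) (z : R[i]) :
  (k *: \prod_(r <- rs) ('X - r%:P)).[z] = k * \prod_(r <- rs) (z - r).
Proof.
rewrite hornerZ horner_prod; congr (_ * _).
by apply: eq_bigr => r _; rewrite hornerXsubC.
Qed.

(* The product of [|P|] over the points [z0 + t] with [t ^ m = s ^ m] is
   [|lead P|^m] times the product of [|(r - z0)^m - s^m| <= 2 |r - z0|^m] over
   the roots [r], hence at most [(2 |P z0|)^m]. *)
Lemma minimum_modulus (P : {poly R[i]}) (m : nat) (z0 : R[i]) (s : R) :
  (0 < m)%N -> (size P <= m.+1)%N -> 0 < s ->
  (forall z, root P z -> s <= cmod (z - z0)) ->
  exists2 z, cmod (z - z0) = s & cmod P.[z] <= 2 * cmod P.[z0].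
Proof.
move=> m0 sP s0 Hroot.
have P0 : P != 0.
  apply: contraTneq s0 => P0; rewrite -leNgt.
  by have := Hroot z0; rewrite P0 root0 subrr cmod0 => /(_ isT).
have [rs Prs] := closed_field_poly_normal P.
have srs : (size rs <= m)%N by rewrite -ltnS -(size_prod_roots P0 Prs).
pose Q : {poly R[i]} := 'X^m - (s%:C%C ^+ m)%:P.
have [ts Qts] := closed_field_poly_normal Q.
have Qm : lead_coef Q = 1 by apply/monicP; exact: monicXnsubC.
have Q0 : Q != 0 by rewrite -lead_coef_eq0 Qm oner_eq0.
have sts : size ts = m.
  by apply/eqP; rewrite -eqSS -(size_prod_roots Q0 Qts) size_XnsubC.
rewrite Qm in Qts.
have Qh z : \prod_(t <- ts) (z - t) = z ^+ m - s%:C%C ^+ m.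
  by rewrite -[LHS]mul1r -horner_roots -Qts !hornerE.
have cts t : t \in ts -> cmod t = s.
  move=> tts; have : cmod (t ^+ m) = cmod (s%:C%C ^+ m).
    congr cmod; apply/eqP; rewrite -subr_eq0 -Qh; apply/eqP.
    by rewrite (big_rem t) //= subrr mul0r.
  rewrite !cmodX cmod_real (gtr0_norm s0) => /eqP.
  by rewrite eqrXn2 ?cmod_ge0 ?ltW // => /eqP.
have sts0 : (0 < size ts)%N by rewrite sts.
have [|||t tts Ht] := @prod_le_exists _ ts (fun t => cmod P.[z0 + t]) (2 * cmod P.[z0]).
- by rewrite mulr_ge0 ?cmod_ge0.
- exact: sts0.
- rewrite sts Prs; set k := lead_coef P.
  have -> : \prod_(t <- ts) cmod (k *: \prod_(r <- rs) ('X - r%:P)).[z0 + t] =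
      cmod k ^+ m * \prod_(r <- rs) cmod ((r - z0) ^+ m - s%:C%C ^+ m).
    under eq_bigr do rewrite horner_roots cmodM cmod_prod.
    rewrite big_split /= big_const_seq count_predT iter_mulr_1 sts.
    rewrite exchange_big /=; congr (_ * _); apply: eq_bigr => r _.
    rewrite -Qh cmod_prod; apply: eq_bigr => t _.
    by rewrite cmodB; congr cmod; ring.
  have -> : (2 * cmod (k *: \prod_(r <- rs) ('X - r%:P)).[z0]) ^+ m =
      cmod k ^+ m * (2 ^+ m * \prod_(r <- rs) cmod (z0 - r) ^+ m).
    rewrite horner_roots cmodM cmod_prod !exprMn mulrCA.
    by rewrite (big_morph (fun u => u ^+ m) (fun u v => exprMn m u v) (expr1n _ m)).
  rewrite ler_wpM2l ?exprn_ge0 ?cmod_ge0 //.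
  apply: le_trans (_ : \prod_(r <- rs) (2 * cmod (z0 - r) ^+ m) <= _); last first.
    rewrite big_split /= big_const_seq count_predT iter_mulr_1 ler_wpM2r //.
      by apply: prodr_ge0 => r _; rewrite exprn_ge0 ?cmod_ge0.
    (* There are at most [m] roots, each contributing a factor [2]. *)
    by rewrite ler_weXn2l // ler1n.
  rewrite big_seq [leRHS]big_seq; apply: ler_prod => r rrs; rewrite cmod_ge0 /=.
  have Pr : root P r.
    by rewrite rootE Prs horner_roots (big_rem r) //= subrr mul0r mulr0.
  have sr := Hroot r Pr; apply: le_trans (ler_cmodB _ _) _.
  rewrite !cmodX cmod_real (gtr0_norm s0) (cmodB z0) mulr2n mulrDl mul1r lerD2l.
  by apply: lerXn2r sr; rewrite nnegrE ?cmod_ge0 ?ltW.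
exists (z0 + t) => //.
by rewrite addrAC subrr add0r cts.
Qed.
End MinimumModulus.

(** * Approximating surviving parameters by points of [Rset] *)

Section Density.
Variable R : realType.

Lemma compact_circle (z : R[i]) (s : R) : compact [set w | cmod (w - z) = s].
Proof.
apply: subclosed_compact (@compact_box R (cmod z + s)) _.
  have cf : continuous (fun w => cmod (w - z)).
    apply: lipschitz_cmod_continuous => u v.
    have -> : u - v = (u - z) - (v - z) by ring.
    rewrite ler_norml lerBlDr; have := lerB_cmod (v - z) (u - z).
    have := lerB_cmod (u - z) (v - z); rewrite (cmodB (v - z)); lra.
  exact: (continuous_closedP _).1 cf _ (@closed_eq _ s).
move=> w /= ws; have wz : cmod w <= cmod z + s.
  by rewrite -ws -[w in cmod w](subrK z) addrC ler_cmodD.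
by split; [apply: le_trans (ler_Re_cmod _) wz|apply: le_trans (ler_Im_cmod _) wz].
Qed.

Lemma psum_continuous (a : nat -> R[i]) N : continuous (fun z => psum a z N).
Proof.
elim: N a => [|N IH] a.
  have -> : (fun z => psum a z 0) = (fun=> 0) by apply/funext => z; exact: big_ord0.
  exact: cst_continuous.
have -> : (fun z => psum a z N.+1) = (fun z => z * psum (fun k => a k.+1) z N + a 0%N).
  apply/funext => z; rewrite /psum big_ord_recl mulr1 addrC mulr_sumr.
  by congr (_ + _); apply: eq_bigr => k _; rewrite exprS mulrCA.
by apply: (continuousMDcst (f := id)); [move=> ?; exact: cvg_id|exact: IH].
Qed.

(** If the series had no zero on the circle, some truncation would exceed its tail bound at each
    point, hence nearby and for all later truncations. By compactness [|P_m| > 2 |P_m z0|] on the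
    whole circle for large [m], against [minimum_modulus]. *)
Lemma zero_on_circle (a : nat -> R[i]) (z0 : R[i]) (s B r : R) :
  (forall k, cmod (a k) <= B) -> cmod z0 + s <= r -> r < 1 -> 0 < s ->
  vanishes a z0 ->
  (forall m z, (0 < m)%N -> psum a z m.+1 = 0 -> s <= cmod (z - z0)) ->
  exists2 z, cmod (z - z0) = s & vanishes a z.
Proof.
move=> aB zr r1 s0 az0 nz; apply: contrapT => nex.
have B0 : 0 <= B by apply: le_trans (aB 0%N); exact: cmod_ge0.
have r0 : 0 <= r by have := cmod_ge0 z0; lra.
have r01 : 0 <= r < 1 by rewrite r0.
have sr z : cmod (z - z0) = s -> cmod z <= r.
  by move=> zs; apply: le_trans zr; rewrite -zs -[z in cmod z](subrK z0) addrC ler_cmodD.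
have aBr z : cmod (z - z0) = s -> forall k, cmod (a k * z ^+ k) <= B * r ^+ k.
  move=> /sr zr' k; rewrite cmodM cmodX ler_pM ?exprn_ge0 ?cmod_ge0 //.
  by rewrite lerXn2r ?nnegrE ?cmod_ge0.
have /compact_near_coveringP/near_covering_withinP cC := @compact_circle z0 s.
have : \forall m \near \oo, [set w | cmod (w - z0) = s] `<=`
    (fun z => 2 * cmod (psum a z0 m.+1) < cmod (psum a z m.+1)).
  apply: cC => z zs.
  have [N HN] : exists N, B / (1 - r) * r ^+ N < cmod (psum a z N).
    apply: contrapT => /forallNP HN; apply: nex; exists z => //.
    apply/cvg_cmodP => e e0; apply: filterS (geometric_lt (B / (1 - r)) r01 e0) => N.
    by rewrite subr0; apply: le_lt_trans; rewrite leNgt; apply/negP.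
  (* Half of the excess pays for moving from [z] to [w]; the other half exceeds
     [2 |psum a z0 m.+1|]. *)
  pose eta := (cmod (psum a z N) - B / (1 - r) * r ^+ N) / 2.
  have eta0 : 0 < eta by rewrite divr_gt0 // subr_gt0.
  have eta40 : 0 < eta / 2 by rewrite divr_gt0.
  have near1 : \forall m \near \oo, (N <= m.+1)%N /\ cmod (psum a z0 m.+1) < eta / 2.
    have /cvg_cmodP/(_ _ eta40)[M _ HM] := az0.
    exists (maxn N M) => // m /=; rewrite geq_max => /andP[Nm Mm].
    split; first exact: leqW.
    by have := HM m.+1 (leqW Mm); rewrite /= subr0.
  have near2 : \forall w \near z, cmod (psum a w N - psum a z N) < eta.
    exact: (psum_continuous (near_cmod _ eta0)).
  exists ([set w | cmod (psum a w N - psum a z N) < eta],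
          [set m | (N <= m.+1)%N /\ cmod (psum a z0 m.+1) < eta / 2]) => //.
  move=> [w m] [/= wz [Nm z0m]] ws.
  have := psum_tail B0 r01 (aBr w ws) Nm.
  have := lerB_cmod (psum a z N) (psum a w N); rewrite cmodB.
  move: HN eta0 wz z0m; rewrite /eta mulrAC; lra.
(* Index [M.+1] instead of [M] makes the degree bound positive. *)
move=> [M _ HM]; have HM1 := HM M.+1 (leqnSn M).
have Hroot z : root (\poly_(k < M.+2) a k) z -> s <= cmod (z - z0).
  by rewrite rootE horner_poly => /eqP; apply: nz.
have [z zs] := minimum_modulus (ltn0Sn M) (size_poly _ _) s0 Hroot.
by rewrite !horner_poly leNgt => /negP; apply; apply: HM1.
Qed.

Lemma survives_closure (n : nat) (c : R[i]) : (1 < n)%N -> 1 < cmod c ->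
  survives n c -> closure (Rset R n `&` exterior R) c.
Proof.
move=> n1 c1 [d [Dd Hd]]; apply/closure_cmodP => e e0; apply: contrapT => nex.
have c0 : c != 0 by rewrite -cmod_gt0 (lt_trans ltr01).
pose a k : R[i] := if k is k'.+1 then (d k')%:~R else 1.
have n2 : 2 <= n%:R :> R by rewrite ler_nat.
have aB k : cmod (a k) <= n%:R - 1.
  case: k => [|k] /=; first by rewrite cmod1; lra.
  exact/cmod_digit/D_le.
pose z0 := c^-1.
have psumE m : psum a z0 m.+1 = orbit c (fun k => (d k)%:~R) 1 m / c ^+ m.
  rewrite orbitE // [c ^+ m * _]mulrC mulfK ?expf_neq0 // /psum big_ord_recl mulr1.
  by congr (_ + _); apply: eq_bigr => k _; rewrite exprVn.
have az0 : vanishes a z0.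
  have cv : (fun m => orbit c (fun k => (d k)%:~R) 1 m / c ^+ m) @ \oo --> (0 : R[i]).
    apply: (@orbit_bounded_cvg _ _ _ _ ((n%:R - 1) / (cmod c - 1))) => // N.
    by rewrite ler_pdivlMr ?subr_gt0 // mulrC.
  apply/cvg_cmodP => u u0; have /cvg_cmodP/(_ u u0)[M _ HM] := cv.
  by exists M.+1 => // -[//|m] /= /HM; rewrite -psumE.
pose x := cmod z0.
have x0 : 0 < x by rewrite cmod_gt0 invr_eq0.
have x1 : x < 1 by rewrite /x cmodV invf_lt1 // (lt_trans ltr01).
(* The three terms keep [z] away from [0], inside the unit disc, and [z^-1] within [e] of [c]. *)
pose del := Num.min (x / 2) (Num.min ((1 - x) / 2) (e * x ^+ 2 / 2)).
have del0 : 0 < del.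
  by rewrite !lt_min !divr_gt0 // ?subr_gt0 // mulr_gt0 // exprn_gt0.
have [d1 d2 d3] : [/\ del <= x / 2, del <= (1 - x) / 2 & del <= e * x ^+ 2 / 2].
  by rewrite !ge_min !lexx !orbT.
have noroot m z : (0 < m)%N -> psum a z m.+1 = 0 -> del <= cmod (z - z0).
  move=> m0 Pz; rewrite leNgt; apply/negP => zd; apply: nex.
  have zlow : x / 2 < cmod z.
    by have := lerB_cmod z0 z; rewrite cmodB -/x; lra.
  have zup : cmod z < 1.
    by have := lerB_cmod z z0; rewrite -/x; lra.
  have zn0 : z != 0 by rewrite -cmod_gt0; lra.
  (* A zero [z] of a truncation gives a point [z^-1] of [Rset], with the digits reversed. *)
  exists z^-1.
    split; last by apply/exteriorP; rewrite cmodV invf_gt1 // cmod_gt0.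
    exists m, (fun j => d (m - j.+1)%N); split => //.
    apply: (@etrans _ _ (psum a z m.+1 / z ^+ m)); last by rewrite Pz mul0r.
    rewrite /psum big_ord_recl mulr1 mulrDl mul1r exprVn; congr (_ + _).
    rewrite mulr_suml [RHS](reindex_inj rev_ord_inj); apply: eq_bigr => j _.
    rewrite lift0 -mulrA; congr (_ * _).
    rewrite subnSK // exprVn -[in z ^+ m](subnK (ltnW (ltn_ord j))) exprD.
    by rewrite invfM mulrA divff ?mul1r // expf_neq0.
  have -> : z^-1 - c = (z0 - z) / (z * z0).
    by rewrite /z0; field; rewrite zn0 c0.
  have zx0 : 0 < cmod z * x by rewrite mulr_gt0 // cmod_gt0.
  rewrite cmod_div cmodM -/x ltr_pdivrMr //.
  rewrite cmodB; apply: lt_le_trans zd (le_trans d3 _).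
  by rewrite -mulrA expr2 mulrAC mulrA -!mulrA ler_pM2l //; nra.
have r01 : 0 <= (1 + x) / 2 < 1 by apply/andP; split; lra.
have a0 : a 0%N != 0 by exact: oner_neq0.
have [N HN] := finitely_many_zeros r01 aB a0.
(* Distinct radii give distinct zeros. *)
pose rad (i : nat) : R := del / i.+2%:R.
have rad0 i : 0 < rad i by rewrite divr_gt0.
have rad1 i : rad i <= del / 2.
  by rewrite ler_pM2l // lef_pV2 ?posrE // ler_nat.
have /choice[f Hf] : forall i, exists z, cmod (z - z0) = rad i /\ vanishes a z.
  move=> i; have [|||||z zr az] := @zero_on_circle a z0 (rad i) (n%:R - 1) ((1 + x) / 2) aB.
  - by have := rad1 i; rewrite -/x; lra.
  - by case/andP: r01.
  - exact: rad0.
  - exact: az0.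
  - move=> m z m0 /(noroot _ _ m0); apply: le_trans.
    by have := rad1 i; lra.
  - by exists z.
have finj : injective f.
  move=> i j fij; have := (Hf i).1; rewrite fij (Hf j).1 /rad.
  move=> /(mulfI (lt0r_neq0 del0))/invr_inj/eqP; rewrite eqr_nat => /eqP[].
  by move=> ->.
suff : (size (map f (iota 0 N)) < N)%N by rewrite size_map size_iota ltnn.
apply: HN.
  by rewrite map_inj_uniq // iota_uniq.
move=> _ /mapP[i _ ->]; have [fr fv] := Hf i; have ri := rad1 i; split => //.
- have := lerB_cmod z0 (f i); rewrite cmodB fr -/x; lra.
- have := lerB_cmod (f i) z0; rewrite fr -/x; lra.
Qed.

End Density.

(** * Identification of [Mset] with the closure of [Rset] *)

Section Closures.
Variables (R : realType) (n : nat).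
Hypothesis n1 : (1 < n)%N.

(** Dividing the equation by [c ^+ m] reverses the digits; padding by the digit [0] gives a series
    with eventually zero partial sums. *)
Lemma Rset_survives c : Rset R n c -> 1 < cmod c -> survives n c.
Proof.
move=> [m [d [m0 Dd Hm]]] c1; have c0 : c != 0 by rewrite -cmod_gt0 (lt_trans ltr01).
apply/survives_series => //.
pose d' k := if (k <= m)%N then d (m - k)%N else 0.
exists d'; split => [k k1|].
  rewrite /d'; case: ifP => km; first by apply: Dd; rewrite ltn_subrL k1.
  rewrite /D /=; lia.
apply/cvg_cmodP => e e0; exists m => // N /= mN.
suff -> : 1 + \sum_(1 <= k < N.+1) (d' k)%:~R * c ^- k = 0 :> R[i].
  by rewrite subrr cmod0.
have tail0 : \sum_(m.+1 <= k < N.+1) (d' k)%:~R * c ^- k = 0 :> R[i].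
  rewrite big_nat_cond big1 // => k /andP[/andP[mk _] _].
  by rewrite /d' leqNgt mk mul0r.
rewrite (@big_cat_nat _ _ _ m.+1) //= tail0 addr0.
apply: (@etrans _ _ ((c ^+ m + \sum_(j < m) (d j)%:~R * c ^+ j) / c ^+ m)); last first.
  by rewrite Hm mul0r.
rewrite mulrDl divff ?expf_neq0 //; congr (_ + _).
rewrite big_add1 /= big_mkord mulr_suml [RHS](reindex_inj rev_ord_inj).
apply: eq_bigr => j _; rewrite /d' ltn_ord /= -mulrA; congr (_ * _).
rewrite -[in c ^+ m](subnK (ltn_ord j)) exprD invfM mulrA divff ?mul1r //.
exact: expf_neq0.
Qed.

Lemma Mset_survives c : Mset R n c <-> 1 < cmod c /\ survives n c.
Proof.
(* Existence excludes the default [set0] of [xget]. *)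
have attrP : 1 < cmod c -> is_attractor c n (attractor c n).
  by move=> c1; exact: xgetPex (attractor_exists (ltnW n1) c1).
split => [[/exteriorP c1 nK]|[c1 sc]].
  by split => //; exact: connected_attractor_survives (attrP c1) nK.
split; first exact/exteriorP.
exact: survives_connected_attractor (attrP c1) sc.
Qed.

Lemma Mset_closure : Mset R n = closure (Rset R n `&` exterior R) `&` exterior R.
Proof.
apply/seteqP; split => [c /Mset_survives[c1 sc]|c [cR /exteriorP c1]].
  by split; [exact: survives_closure|exact/exteriorP].
apply/Mset_survives; split => //; apply: closed_survives.
by apply: closure_subset cR => w [Rw /exteriorP w1]; exact: Rset_survives.
Qed.

End Closures.

(* [closure (_ : set (subspace U))] is the closure in the subspace U: the points
   outside U are isolated in [subspace U], so sets contained in U have their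
   closure contained in U. *)
Theorem proposition1p1 (R : realType) (n : nat) (hn : (2 <= n)%N) :
  [/\ Mset R n = closure (Rset R n `&` exterior R) `&` exterior R,
      closure (Rset R n `&` exterior R) `&` exterior R =
        closure (Rset R n `&` exterior R : set (subspace (exterior R))),
      closed (Mset R n : set (subspace (exterior R))) &
      forall c : R[i],
        Mset R n c <->
        exterior R c /\
        exists d : nat -> int,
          (forall k, (1 <= k)%N -> D n (d k)) /\
          (fun N : nat => 1 + \sum_(1 <= k < N.+1) (d k)%:~R * c ^- k : R[i])
            @ \oo --> (0 : R[i])].
Proof.
have E : closure (Rset R n `&` exterior R) `&` exterior R =
    closure (Rset R n `&` exterior R : set (subspace (exterior R))).
  by rewrite closure_subspaceW //; exact: subIsetr.
split => //; first exact: Mset_closure.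
  by rewrite Mset_closure // E; exact: closed_closure.
move=> c; split => [/(Mset_survives hn)[c1 sc]|[/exteriorP c1 sc]].
  by split; [exact/exteriorP|exact/survives_series].
by apply/Mset_survives => //; split => //; apply/survives_series.
Qed.
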